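(* Let $m \geq 2$. The following are full totally umbilical lightlike submanifolds in a pseudo-hyperbolic space (the indicated target): (1) $\mathbb{H}^{m-1}_{s}(-1) \times \mathbb{E}^{0,0,1} \rightarrow \mathbb{H}^{m+1}_{s+1}(-1)$; $(x,t) \mapsto (t,x,t)$ (totally geodesic); (2) $\mathbb{H}^{m-1}_{s}(-r^2) \times \mathbb{E}^{0,0,1} \rightarrow \mathbb{H}^{m+2}_{s+2}(-1)$; $(x,t) \mapsto (t,\sqrt{1-r^{2}},x,t)$ ($0<r<1$); (3) $\mathbb{H}^{m-1}_{s}(-r^2) \times \mathbb{E}^{0,0,1} \rightarrow \mathbb{H}^{m+2}_{s+1}(-1)$; $(x,t) \mapsto (t,x,\sqrt{r^{2}-1},t)$ ($r>1$); (4) $\mathbb{S}^{m-1}_{s}(r^2) \times \mathbb{E}^{0,0,1} \rightarrow \mathbb{H}^{m+2}_{s+1}(-1)$; $(x,t) \mapsto (t,\sqrt{1+r^{2}},x,t)$ ($r>0$); (5) $\Lambda^{m}_{s} \rightarrow \mathbb{H}^{m+1}_{s+1}(-1)$; $x \mapsto (1,x)$; (6) $\Lambda^{m-1}_{s} \times \mathbb{E}^{0,0,1} \rightarrow \mathbb{H}^{m+2}_{s+2}(-1)$; $(x,t) \mapsto (t,1,x,t)$; (7) $\mathbb{H}^{m-1}_{s}(-1) \times \mathbb{E}^{0,0,1} \rightarrow \mathbb{H}^{m+3}_{s+2}(-1)$; $(x,t) \mapsto (t,1,x,1,t)$. Here (6) is $2$-lightlike, and the others are $1$-lightlike.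
   Context: $\mathbb{E}^{n}_{p}$ is $\mathbb{R}^n$ with the metric $\langle\cdot,\cdot\rangle_p=-\sum_{i=1}^{p}dx_i^2+\sum_{j=p+1}^{n}dx_j^2$ (the first $p$ coordinates are the negative ones), and $\mathbb{E}^{0,0,1}$ is $\mathbb{R}$ with the zero (degenerate) metric. For $r>0$, $$\mathbb{S}^{n}_{p}(r^2)=\{x\in\mathbb{E}^{n+1}_{p}\mid\langle x,x\rangle_p=r^2\},\quad \mathbb{H}^{n}_{p}(-r^2)=\{x\in\mathbb{E}^{n+1}_{p+1}\mid\langle x,x\rangle_{p+1}=-r^2\},$$ with the induced metrics, and the lightcone of dimension $n$ and index $p$ is $$\Lambda^{n}_{p}=\{x\in\mathbb{E}^{n+1}_{p+1}\setminus\{0\}\mid\langle x,x\rangle_{p+1}=0\},$$ with the induced (degenerate) metric. An immersion $\phi:M\to\bar M$ into a pseudo-Riemannian manifold $(\bar M,\bar g)$ is $r$-lightlike if the induced metric $g=\phi^*\bar g$ is degenerate and its radical distribution $\mathrm{Rad}\,TM=\{X\in TM\mid g(X,Y)=0\text{ for all }Y\in TM\}$ has constant rank $r>0$; then $\phi(M)$ is called an ($r$-)lightlike submanifold. One chooses a transversal vector bundle $\mathrm{tr}(TM)$, i.e. a vector bundle over $M$ with (not necessarily orthogonal) direct sum decomposition $\phi^*T\bar M=TM\oplus\mathrm{tr}(TM)$, and writes $\bar\nabla_XY=\check\nabla_XY+B(X,Y)$ for $X,Y\in\Gamma(TM)$, where $\bar\nabla$ is the Levi-Civita connection of $\bar M$,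 $\check\nabla_XY$ is the $TM$-component and $B(X,Y)$ is the $\mathrm{tr}(TM)$-component. The lightlike immersion is totally geodesic if $B=0$, and totally umbilical if there is a section $\mathcal{H}$ of $\mathrm{tr}(TM)$ with $B(X,Y)=g(X,Y)\mathcal{H}$ for all $X,Y\in\Gamma(TM)$; these notions do not depend on the choice of $\mathrm{tr}(TM)$. Full means that the image is not contained in any non-degenerate totally geodesic hypersurface of the target. *)

(* Defs.v *)
From HB Require Import structures.
From mathcomp Require Import all_boot all_order all_algebra.
From mathcomp Require Import all_classical all_reals all_analysis.
Set Implicit Arguments.
Unset Strict Implicit.
Unset Printing Implicit Defensive.
Import Order.TTheory GRing.Theory Num.Theory.
Import numFieldNormedType.Exports.
Local Open Scope classical_set_scope.
Local Open Scope ring_scope.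

(* C^k on U, meant for U open: C^(k+1) is differentiability on U together
   with C^k-ness of every directional derivative. *)
Fixpoint Ck (R : realType) (V W : normedModType R) (k : nat) (U : set V)
    (f : V -> W) : Prop :=
  match k with
  | 0 => forall x, U x -> {for x, continuous f}
  | k'.+1 => (forall x, U x -> differentiable f x) /\
             (forall v, Ck k' U (fun x => 'd f x v))
  end.

Definition smooth_on (R : realType) (V W : normedModType R) (U : set V)
    (f : V -> W) : Prop :=
  open U /\ forall k, Ck k U f.

Definition smooth_along (R : realType) (V W : normedModType R) (M : set V)
    (f : V -> W) : Prop :=
  forall x, M x -> exists U (F : V -> W),
    [/\ smooth_on U F, U x & forall y, U y -> M y -> f y = F y].

Definition diffeomorphism (R : realType) (n : nat) (U V : set 'rV[R]_n)
    (Phi Psi : 'rV[R]_n -> 'rV[R]_n) : Prop :=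
  [/\ smooth_on U Phi, smooth_on V Psi,
      forall y, U y -> V (Phi y) /\ Psi (Phi y) = y &
      forall z, V z -> U (Psi z) /\ Phi (Psi z) = z].

(* d-dimensional embedded C^oo submanifold of R^n, by slice charts: locally M
   is straightened to the subspace spanned by the first d coordinates. *)
Definition submanifold (R : realType) (n d : nat) (M : set 'rV[R]_n) : Prop :=
  (d <= n)%N /\
  forall x, M x -> exists U V Phi Psi,
    [/\ diffeomorphism U V Phi Psi, U x &
        forall y, U y ->
          (M y <-> forall i : 'I_n, (d <= i)%N -> Phi y 0 i = 0)].

Definition tangent (R : realType) (n : nat) (M : set 'rV[R]_n)
    (x v : 'rV[R]_n) : Prop :=
  exists (J : set R) (c : R -> 'rV[R]_n),
    [/\ smooth_on J c, J 0, forall t, J t -> M (c t), c 0 = x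
      & derive1 c 0 = v].

(* Local sections of TM over M `&` U, given by an extension to U. *)
Definition vector_field (R : realType) (n : nat) (M U : set 'rV[R]_n)
    (X : 'rV[R]_n -> 'rV[R]_n) : Prop :=
  smooth_on U X /\ forall y, U y -> M y -> tangent M y (X y).

(* For fields tangent to M the values on M depend only on X and Y along M. *)
Definition lie_bracket (R : realType) (n : nat) (X Y : 'rV[R]_n -> 'rV[R]_n)
    (x : 'rV[R]_n) : 'rV[R]_n :=
  'd Y x (X x) - 'd X x (Y x).

Definition form (R : realType) (n : nat) := 'rV[R]_n -> 'rV[R]_n -> R.

Definition nondegenerate (R : realType) (n : nat) (M : set 'rV[R]_n)
    (g : form R n) : Prop :=
  forall x v, M x -> tangent M x v ->
    (forall w, tangent M x w -> g v w = 0) -> v = 0.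

Definition pseudo_riemannian (R : realType) (n d : nat) (M : set 'rV[R]_n)
    (g : form R n) : Prop :=
  submanifold d M /\ nondegenerate M g.

(* [nabla x v Y] is the derivative at x of the local field Y in direction v.
   It is constrained only when x lies on M, v is tangent to M at x and Y is a
   vector field of M near x. *)
Definition connection (R : realType) (n : nat) :=
  'rV[R]_n -> 'rV[R]_n -> ('rV[R]_n -> 'rV[R]_n) -> 'rV[R]_n.

Record is_levi_civita (R : realType) (n : nat) (M : set 'rV[R]_n)
    (g : form R n) (nabla : connection R n) : Prop := IsLeviCivita {
  lc_tangent : forall U Y x v, vector_field M U Y -> U x -> M x ->
    tangent M x v -> tangent M x (nabla x v Y);
  lc_local : forall U Y Y' x v, vector_field M U Y -> vector_field M U Y' ->
    U x -> M x -> tangent M x v ->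
    (forall y, U y -> M y -> Y y = Y' y) -> nabla x v Y = nabla x v Y';
  lc_smooth : forall U X Y, vector_field M U X -> vector_field M U Y ->
    smooth_along (M `&` U) (fun y => nabla y (X y) Y);
  lc_linear : forall U Y x v w (a : R), vector_field M U Y -> U x -> M x ->
    tangent M x v -> tangent M x w ->
    nabla x (a *: v + w) Y = a *: nabla x v Y + nabla x w Y;
  lc_additive : forall U Y Z x v, vector_field M U Y -> vector_field M U Z ->
    U x -> M x -> tangent M x v ->
    nabla x v (fun y => Y y + Z y) = nabla x v Y + nabla x v Z;
  lc_leibniz : forall U (f : 'rV[R]_n -> R) Y x v, smooth_on U f ->
    vector_field M U Y -> U x -> M x -> tangent M x v ->
    nabla x v (fun y => f y *: Y y) = 'd f x v *: Y x + f x *: nabla x v Y;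
  lc_torsion_free : forall U X Y x, vector_field M U X -> vector_field M U Y ->
    U x -> M x -> nabla x (X x) Y - nabla x (Y x) X = lie_bracket X Y x;
  lc_metric : forall U Y Z x v, vector_field M U Y -> vector_field M U Z ->
    U x -> M x -> tangent M x v ->
    'd (fun y => g (Y y) (Z y)) x v
      = g (nabla x v Y) (Z x) + g (Y x) (nabla x v Z)
}.

(* Selected by choice; on a pseudo-Riemannian M all candidates agree on the
   arguments that [is_levi_civita] constrains. *)
Definition levi_civita (R : realType) (n : nat) (M : set 'rV[R]_n)
    (g : form R n) : connection R n :=
  xget (fun _ _ _ => 0) [set nabla : connection R n | is_levi_civita M g nabla].

Definition immersion (R : realType) (k n : nat) (M : set 'rV[R]_k)
    (phi : 'rV[R]_k -> 'rV[R]_n) (Mbar : set 'rV[R]_n) : Prop :=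
  [/\ exists2 U, smooth_on U phi & M `<=` U,
      forall x, M x -> Mbar (phi x) &
      forall x v, M x -> tangent M x v -> 'd phi x v = 0 -> v = 0].

Definition pullback (R : realType) (k n : nat) (phi : 'rV[R]_k -> 'rV[R]_n)
    (gbar : form R n) (x v w : 'rV[R]_k) : R :=
  gbar ('d phi x v) ('d phi x w).

Definition isometric (R : realType) (k n : nat) (M : set 'rV[R]_k)
    (g : form R k) (phi : 'rV[R]_k -> 'rV[R]_n) (gbar : form R n) : Prop :=
  forall x v w, M x -> tangent M x v -> tangent M x w ->
    pullback phi gbar x v w = g v w.

Definition radical (R : realType) (k n : nat) (M : set 'rV[R]_k)
    (phi : 'rV[R]_k -> 'rV[R]_n) (gbar : form R n) (x : 'rV[R]_k)
    : set 'rV[R]_k :=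
  [set v | tangent M x v /\
           forall w, tangent M x w -> pullback phi gbar x v w = 0].

Definition basis_rows (R : realType) (r n : nat) (S : set 'rV[R]_n)
    (A : 'M[R]_(r, n)) : Prop :=
  row_free A /\ forall v, S v <-> (v <= A)%MS.

Definition lightlike (R : realType) (k n r : nat) (M : set 'rV[R]_k)
    (phi : 'rV[R]_k -> 'rV[R]_n) (gbar : form R n) : Prop :=
  (0 < r)%N /\
  forall x, M x -> exists A : 'M[R]_(r, k), basis_rows (radical M phi gbar x) A.

(* tr x is the fibre over x of a smooth rank c complement of dphi(TM) in the
   restriction of TMbar to M. *)
Definition transversal_bundle (R : realType) (k n : nat) (M : set 'rV[R]_k)
    (phi : 'rV[R]_k -> 'rV[R]_n) (Mbar : set 'rV[R]_n)
    (tr : 'rV[R]_k -> set 'rV[R]_n) : Prop :=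
  [/\ exists c, forall x, M x -> exists U (A : 'rV[R]_k -> 'M[R]_(c, n)),
        [/\ smooth_on U A, U x &
            forall y, U y -> M y -> basis_rows (tr y) (A y)],
      forall x b, M x -> tr x b -> tangent Mbar (phi x) b,
      forall x w, M x -> tangent Mbar (phi x) w -> exists v b,
        [/\ tangent M x v, tr x b & w = 'd phi x v + b] &
      forall x v, M x -> tangent M x v -> tr x ('d phi x v) ->
        'd phi x v = 0].

(* w is the value at x of the derivative of dphi(Y) along X with respect to
   the connection nabla of Mbar, computed from a vector field Ybar of Mbar
   extending dphi(Y). *)
Definition derivative_along (R : realType) (k n : nat) (M : set 'rV[R]_k)
    (phi : 'rV[R]_k -> 'rV[R]_n) (Mbar : set 'rV[R]_n)
    (nabla : connection R n) (X Y : 'rV[R]_k -> 'rV[R]_k)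
    (x : 'rV[R]_k) (w : 'rV[R]_n) : Prop :=
  exists V Ybar,
    [/\ vector_field Mbar V Ybar, V (phi x),
        \forall y \near x, M y -> Ybar (phi y) = 'd phi y (Y y)
      & w = nabla (phi x) ('d phi x (X x)) Ybar].

(* b = B(X,Y) at x: the tr-component of the above derivative. *)
Definition second_fundamental_form (R : realType) (k n : nat)
    (M : set 'rV[R]_k) (phi : 'rV[R]_k -> 'rV[R]_n) (Mbar : set 'rV[R]_n)
    (nabla : connection R n) (tr : 'rV[R]_k -> set 'rV[R]_n)
    (X Y : 'rV[R]_k -> 'rV[R]_k) (x : 'rV[R]_k) (b : 'rV[R]_n) : Prop :=
  tr x b /\ exists2 v, tangent M x v &
    derivative_along M phi Mbar nabla X Y x ('d phi x v + b).

Definition totally_geodesic (R : realType) (k n : nat) (M : set 'rV[R]_k)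
    (phi : 'rV[R]_k -> 'rV[R]_n) (Mbar : set 'rV[R]_n) (gbar : form R n)
    : Prop :=
  exists2 tr, transversal_bundle M phi Mbar tr &
    forall U X Y x b, vector_field M U X -> vector_field M U Y -> U x -> M x ->
      second_fundamental_form M phi Mbar (levi_civita Mbar gbar) tr X Y x b ->
      b = 0.

Definition totally_umbilical (R : realType) (k n : nat) (M : set 'rV[R]_k)
    (phi : 'rV[R]_k -> 'rV[R]_n) (Mbar : set 'rV[R]_n) (gbar : form R n)
    : Prop :=
  exists tr (H : 'rV[R]_k -> 'rV[R]_n),
    [/\ transversal_bundle M phi Mbar tr,
        smooth_along M H, forall x, M x -> tr x (H x) &
        forall U X Y x b, vector_field M U X -> vector_field M U Y ->
          U x -> M x ->
          second_fundamental_form M phi Mbar (levi_civita Mbar gbar) tr X Y x b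
          -> b = pullback phi gbar x (X x) (Y x) *: H x].

(* dbar is the dimension of Mbar. As N is non-degenerate, its second
   fundamental form vanishes iff derivatives of tangent fields stay tangent. *)
Definition nondegenerate_totally_geodesic_hypersurface (R : realType)
    (n dbar : nat) (Mbar : set 'rV[R]_n) (gbar : form R n)
    (N : set 'rV[R]_n) : Prop :=
  [/\ N `<=` Mbar, pseudo_riemannian dbar.-1 N gbar &
      forall U X Y x w, vector_field N U X -> vector_field N U Y ->
        U x -> N x ->
        derivative_along N id Mbar (levi_civita Mbar gbar) X Y x w ->
        tangent N x w].

Definition full (R : realType) (k n dbar : nat) (M : set 'rV[R]_k)
    (phi : 'rV[R]_k -> 'rV[R]_n) (Mbar : set 'rV[R]_n) (gbar : form R n)
    : Prop :=
  ~ exists2 N, nondegenerate_totally_geodesic_hypersurface dbar Mbar gbar N &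
               phi @` M `<=` N.

(* phi is an isometric immersion of the d-dimensional manifold M, with the
   possibly degenerate metric g, into the dbar-dimensional Mbar. *)
Definition full_umbilical_lightlike (R : realType) (k n d dbar r : nat)
    (M : set 'rV[R]_k) (g : form R k) (phi : 'rV[R]_k -> 'rV[R]_n)
    (Mbar : set 'rV[R]_n) (gbar : form R n) : Prop :=
  [/\ submanifold d M, pseudo_riemannian dbar Mbar gbar, immersion M phi Mbar
    & isometric M g phi gbar] /\
  [/\ lightlike r M phi gbar, totally_umbilical M phi Mbar gbar
    & full dbar M phi Mbar gbar].

(* The metric of index p on E^n_p. *)
Definition pform (R : realType) (n p : nat) : form R n :=
  fun x y =>
    \sum_(i < n) (if (i < p)%N then - (x 0 i * y 0 i) else x 0 i * y 0 i).
Arguments pform {R n} p.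

(* Below n is the number of coordinates, so that the three sets have
   dimension n - 1: S^(n-1)_p(r^2), H^(n-1)_p(-r^2) and Lambda^(n-1)_p. *)
Definition pseudo_sphere (R : realType) (n p : nat) (r : R) : set 'rV[R]_n :=
  [set x | pform p x x = r ^+ 2].

Definition pseudo_hyperbolic (R : realType) (n p : nat) (r : R)
    : set 'rV[R]_n :=
  [set x | pform p.+1 x x = - r ^+ 2].

Definition lightcone (R : realType) (n p : nat) : set 'rV[R]_n :=
  [set x | x != 0 /\ pform p.+1 x x = 0].
Arguments lightcone R n p : clear implicits.

(* The product of M with E^{0,0,1}; (x, t) is the row vector row_mx x t. *)
Definition times_line (R : realType) (n : nat) (M : set 'rV[R]_n)
    : set 'rV[R]_(n + 1) :=
  [set z | M (lsubmx z)].

Definition times_line_form (R : realType) (n : nat) (g : form R n)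
    : form R (n + 1) :=
  fun v w => g (lsubmx v) (lsubmx w).

(* Main.v *)
(* Let q be a (possibly degenerate) symmetric form on R^k.  The level set
   M = {z | q(z,.) != 0, q(z,z) = K} is a hypersurface with T_z M the kernel of
   q(z,.), and each M of the statement has this form, as has the target, where q
   is nondegenerate and K = -1.  On the target the Levi-Civita connection is the
   flat derivative followed by the projection along the position vector.

   Every map of the statement is phi(z) = L z + c0 with L an injective linear
   isometry and c0 orthogonal to its image, <c0,c0> = -1 - K.  The derivative
   of dphi(Y) along X is then L (D_X Y) - q(X,Y) phi(z), where
   q(z, D_X Y) = -q(X,Y), so that modulo dphi(TM) it is q(X,Y) times a vector
   independent of X and Y: phi is umbilical, and geodesic if c0 = 0.  The
   radical at z is ker q, together with the line of z when K = 0.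

   For fullness, let phi(M) lie in a nondegenerate totally geodesic hypersurface
   N and let xi be normal to N in the target, so <xi,xi> != 0.  First derivatives
   give <xi, L x> = l q(z,x) for some l, and second derivatives give
   l q(v,v) = 0 for v tangent to M, hence l K = 0.  Then xi - l (L z) is
   orthogonal to c0 and to the image of L, which in all seven cases forces it,
   and therefore xi, to be null. *)
From HB Require Import structures.
Require Import Defs.
From mathcomp Require Import all_boot all_order all_algebra.
From mathcomp Require Import all_classical all_reals all_analysis.
From mathcomp Require Import ring lra.
Import Order.TTheory GRing.Theory Num.Theory.
Import numFieldNormedType.Exports.
Set Implicit Arguments.
Unset Strict Implicit.
Unset Printing Implicit Defensive.
Local Open Scope classical_set_scope.
Local Open Scope ring_scope.
(** * Calculus of smooth functions *)

(** Several features of the definitions shape the proof. Tangent vectors are velocities of curves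
    and submanifolds are given by slice charts, so each quadric needs a chart in closed form: it is
    found by solving a quadratic equation along one transversal direction. The Levi-Civita
    connection is a choice among the maps that satisfy the axioms, so its formula takes both an
    existence and a uniqueness argument. Total geodesy of [N] is tested on fields of [N] only, while
    dphi(X) is a field along [M]; it is therefore expanded in a frame taken from a slice chart of
    [N] before it is differentiated.

    Admitting degenerate [S] and [K = 0] treats spheres, hyperbolic spaces, cones and their products
    with a line alike. The price is that for [K = 0] the position vector is tangent to [M] and
    cannot serve as a normal. [conormal] replaces it: the form [qf S z] is 1 on it, and it yields
    the chart, local tangent fields and the transversal frame.

    In the last step of fullness, passing from [xi] to [xi - l (L z)] changes the norm by
    [- 2 l^2 K + l^2 K], which is zero because [l K = 0]. *)

Definition entry (R : realType) m n i j (A : 'M[R]_(m, n)) : R := A i j.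

Lemma entry_linear (R : realType) m n i j : linear (@entry R m n i j).
Proof. by move=> a A B; rewrite /entry !mxE. Qed.

HB.instance Definition _ (R : realType) m n i j :=
  GRing.isLinear.Build R 'M[R]_(m, n) R _ (@entry R m n i j)
    (@entry_linear R m n i j).

Section Calculus.
Context {R : realType} {V : normedModType R}.
Implicit Types (W : normedModType R) (U : set V).

(** The difference [h = g - f] vanishes near [x], so the zero map meets the characterization of its
    differential, and [g = f + h]. *)
Lemma differentiable_near_eq W (f g : V -> W) x :
  (\near x, f x = g x) -> differentiable f x -> differentiable g x.
Proof.
move=> fg df; pose h : V -> W := g - f.
have h0 : \forall y \near x, h y = 0.
  near=> y; change (g y - f y = 0); suff -> : f y = g y by rewrite subrr.
  by near: y.
suff dh : differentiable h x.
  rewrite (_ : g = f + h); first exact: differentiableD.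
  by rewrite /h addrC subrK.
have hE : h \o shift x = cst (h x) + 0 +o_ 0 id.
  apply/eqaddoP => e e0; near=> y.
  rewrite !fctE /= (nbhs_singleton h0) addr0 subr0.
  suff -> : h (y + x) = 0 by rewrite normr0 mulr_ge0// ltW.
  near: y; move: h0; rewrite (near_shift 0 x) => h0.
  by near=> y; rewrite -[x]subr0; near: y.
have d0 : 'd h x = 0 :> (V -> W).
  by apply: (@diff_unique _ _ _ h \0) => //; exact: cst_continuous.
by apply/diff_locallyP; rewrite d0; split=> //; exact: cst_continuous.
Unshelve. all: by end_near. Qed.

Lemma diff_near_eq W (f g : V -> W) x v : (\near x, f x = g x) ->
  differentiable f x -> 'd f x v = 'd g x v.
Proof.
move=> fg df; rewrite -!deriveE//; last exact: differentiable_near_eq df.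
exact: near_eq_derive.
Qed.

Lemma differentiable_sumf W (I : finType) (f : I -> V -> W) x :
  (forall i, differentiable (f i) x) ->
  differentiable (fun y => \sum_i f i y) x.
Proof.
move=> df; rewrite (_ : (fun _ => _) = \sum_i f i); last by rewrite fct_sumE.
elim/big_ind : _ => [|? ?|i _].
- exact: differentiable_cst.
- exact: differentiableD.
- exact: df.
Qed.

Lemma diff_sumf W (I : finType) (f : I -> V -> W) x v :
  (forall i, differentiable (f i) x) ->
  'd (fun y => \sum_i f i y) x v = \sum_i 'd (f i) x v.
Proof.
move=> df; rewrite (_ : (fun _ => _) = \sum_i f i); last by rewrite fct_sumE.
suff [//] : differentiable (\sum_i f i) x /\
  'd (\sum_i f i) x v = \sum_i 'd (f i) x v.
elim/big_ind2 : _ => [|f1 d1 f2 d2 [? <-] [? <-]|i _].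
- by split; [exact: differentiable_cst|rewrite (diff_cst 0)].
- by split; [exact: differentiableD|rewrite diffD].
- by split; [exact: df|].
Qed.

Lemma differentiable_mx m n (f : V -> 'M[R]_(m, n)) x :
  (forall i j, differentiable (fun y => f y i j) x) -> differentiable f x.
Proof.
move=> df.
rewrite (_ : f = fun y => \sum_i \sum_j f y i j *: delta_mx i j); last first.
  by apply/funext => y; exact: matrix_sum_delta.
apply: differentiable_sumf => i; apply: differentiable_sumf => j.
exact: differentiableZl.
Qed.

Lemma differentiable_entry m n (f : V -> 'M[R]_(m, n)) x i j :
  differentiable f x -> differentiable (fun y => f y i j) x.
Proof.
move=> df; apply: (@differentiable_comp _ _ _ _ f (fun N : 'M[R]_(m, n) => N i j)) => //.
exact: differentiable_coord.
Qed.

Lemma diff_lincomp (V' W : normedModType R) (l : {linear V' -> W}) (f : V -> V') x v :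
  continuous l -> differentiable f x -> 'd (l \o f) x v = l ('d f x v).
Proof.
move=> cl df; have dl := @linear_differentiable _ _ _ l (f x) cl.
have /(congr1 (fun h : V -> W => h v)) E := diff_comp df dl.
by apply: etrans E _; rewrite /= diff_lin.
Qed.

Lemma diff_entry m n (f : V -> 'M[R]_(m, n)) x v i j :
  differentiable f x -> 'd (fun y => f y i j) x v = 'd f x v i j.
Proof. exact: (@diff_lincomp _ _ (entry i j)) (@coord_continuous _ _ _ i j). Qed.

Lemma diff_mulr (f g : V -> R) x v :
  differentiable f x -> differentiable g x ->
  'd (fun y => f y * g y) x v = 'd f x v * g x + f x * 'd g x v.
Proof.
move=> df dg; have /(congr1 (fun h : V -> R => h v)) /= E := diffM df dg.
apply: etrans E _; rewrite addrC /=; congr (_ + _); exact: mulrC.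
Qed.

Lemma Ck_ext W k U (f g : V -> W) : open U -> (forall x, U x -> f x = g x) ->
  Ck k U f -> Ck k U g.
Proof.
move=> oU; elim: k f g => [|k IH] f g fg /= fk.
  move=> x Ux; have : f @ x --> f x by exact: fk.
  rewrite (fg x Ux); apply: cvg_trans.
  apply: near_eq_cvg; near=> y; apply: fg; near: y.
  exact: open_nbhs_nbhs.
case: fk => df dfk.
have fgn x : U x -> \near x, f x = g x.
  by move=> Ux; near=> y; apply: fg; near: y; exact: open_nbhs_nbhs.
split=> [x Ux|v].
  exact: differentiable_near_eq (fgn x Ux) (df x Ux).
apply: IH (dfk v) => x Ux.
exact: diff_near_eq (fgn x Ux) (df x Ux).
Unshelve. all: by end_near. Qed.

Lemma CkSP W k U (f : V -> W) : Ck k.+1 U f ->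
  (forall x, U x -> differentiable f x) /\ (forall v, Ck k U (fun x => 'd f x v)).
Proof. by []. Qed.

(** The rules for ['d f x v] hold only at points of [U], whereas [Ck] is a condition on a function
    defined on all of [V]. Any [h] that agrees with the derivative on [U] may stand in for it. *)
Lemma CkS_ext W k U (f : V -> W) : open U ->
  (forall x, U x -> differentiable f x) ->
  (forall v, exists2 h, Ck k U h & forall x, U x -> h x = 'd f x v) ->
  Ck k.+1 U f.
Proof.
move=> oU df dfk; split=> // v; have [h hk hE] := dfk v.
exact: Ck_ext hE hk.
Qed.

Lemma CkW W k U (f : V -> W) : Ck k.+1 U f -> Ck k U f.
Proof.
elim: k f => [|k IH] f [df dfk].
  by move=> x /df; exact: differentiable_continuous.
by split=> // v; apply: IH (dfk v).
Qed.

Lemma Ck_cst W k U (a : W) : open U -> Ck k U (fun _ : V => a).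
Proof.
move=> oU; elim: k a => [|k IH] a; first by move=> x _; exact: cst_continuous.
apply: (CkS_ext oU) => [x _|v]; first exact: differentiable_cst.
exists (fun=> 0); first exact: IH.
by move=> x _; rewrite (diff_cst a).
Qed.

Lemma Ck_linear W k U (f : {linear V -> W}) : open U -> continuous f -> Ck k U f.
Proof.
move=> oU cf; case: k => [|k]; first by move=> x _; exact: cf.
apply: (CkS_ext oU) => [x _|v]; first exact: linear_differentiable.
by exists (fun=> f v); [exact: Ck_cst|move=> x _; rewrite diff_lin].
Qed.

Lemma CkD W k U (f g : V -> W) : open U -> Ck k U f -> Ck k U g ->
  Ck k U (fun y => f y + g y).
Proof.
move=> oU; elim: k f g => [|k IH] f g fk gk.
  by move=> x Ux; apply: continuousD; [exact: fk|exact: gk].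
have [[df dfk] [dg dgk]] := (CkSP fk, CkSP gk).
apply: (CkS_ext oU) => [x Ux|v].
  by apply: differentiableD; [exact: df|exact: dg].
exists (fun y => 'd f y v + 'd g y v); first exact: IH.
move=> x Ux; have /(congr1 (fun h : V -> W => h v)) := diffD (df x Ux) (dg x Ux).
exact: esym.
Qed.

Lemma Ck_sum W k U (I : finType) (f : I -> V -> W) : open U ->
  (forall i, Ck k U (f i)) -> Ck k U (fun y => \sum_i f i y).
Proof.
move=> oU fk; rewrite (_ : (fun _ => _) = \sum_i f i); last by rewrite fct_sumE.
elim/big_ind : _ => [|? ?|i _]; [exact: Ck_cst|exact: CkD|exact: fk].
Qed.

Lemma CkM k U (f g : V -> R) : open U -> Ck k U f -> Ck k U g ->
  Ck k U (fun y => f y * g y).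
Proof.
move=> oU; elim: k f g => [|k IH] f g fk gk.
  by move=> x Ux; apply: continuousM; [exact: fk|exact: gk].
have [f0 g0] := (CkW fk, CkW gk).
have [[df dfk] [dg dgk]] := (CkSP fk, CkSP gk).
apply: (CkS_ext oU) => [x Ux|v].
  by apply: (@differentiableM _ _ f g); [exact: df|exact: dg].
exists (fun y => 'd f y v * g y + f y * 'd g y v).
  by apply: (CkD oU); apply: IH.
by move=> x Ux; rewrite diff_mulr; [by []|exact: df|exact: dg].
Qed.

Lemma CkN k U (f : V -> R) : open U -> Ck k U f -> Ck k U (fun y => - f y).
Proof.
move=> oU fk; apply: (@Ck_ext _ _ _ (fun y => -1 * f y)) => //.
  by move=> x _; rewrite mulN1r.
by apply: (CkM oU) => //; exact: Ck_cst.
Qed.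

Lemma CkV k U (f : V -> R) : open U -> (forall x, U x -> f x != 0) ->
  Ck k U f -> Ck k U (fun y => (f y)^-1).
Proof.
move=> oU f0; elim: k => [|k IH] fk.
  by move=> x Ux; apply: continuousV; [exact: f0|exact: fk].
have fk' := IH (CkW fk); have [df dfk] := CkSP fk.
apply: (CkS_ext oU) => [x Ux|v].
  by apply: differentiableV; [exact: df|exact: f0].
exists (fun y => - ((f y)^-1 * (f y)^-1) * 'd f y v).
  by apply: (CkM oU) => //; apply: (CkN oU); apply: (CkM oU).
move=> x Ux; apply: esym.
have /(congr1 (fun h : V -> R => h v)) E := diffV (df x Ux) (f0 x Ux).
by apply: etrans E _; rewrite expr2 invfM.
Qed.

Lemma Ck_sqrt k U (f : V -> R) : open U -> (forall x, U x -> 0 < f x) ->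
  Ck k U f -> Ck k U (fun y => Num.sqrt (f y)).
Proof.
move=> oU f0; elim: k => [|k IH] fk.
  by move=> x Ux; apply: continuous_comp; [exact: fk|exact: sqrt_continuous].
have fk' := IH (CkW fk).
have [df dfk] := CkSP fk.
have dsq x : U x -> differentiable (@Num.sqrt R) (f x).
  by move=> Ux; apply/derivable1_diffP; have [] := is_derive1_sqrt (f0 x Ux).
apply: (CkS_ext oU) => [x Ux|v].
  by apply: differentiable_comp; [exact: df|exact: dsq].
exists (fun y => (2 * Num.sqrt (f y))^-1 * 'd f y v).
  apply: CkM => //; apply: CkV => //; last by apply: (CkM oU) => //; exact: Ck_cst.
  by move=> x Ux; rewrite mulf_neq0 ?pnatr_eq0// gt_eqF// sqrtr_gt0 f0.
move=> x Ux; apply: esym.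
have /(congr1 (fun h : V -> R => h v)) E := diff_comp (df x Ux) (dsq x Ux).
apply: etrans E _.
have dv : derivable (@Num.sqrt R) (f x) 1 by apply/derivable1_diffP; exact: dsq.
have /(congr1 (fun h : R -> R => h ('d f x v))) E := deriv1E dv.
by apply: etrans E _; rewrite derive1E derive_sqrt ?f0//; exact: mulrC.
Qed.

Lemma Ck_lincomp (V' W : normedModType R) (l : {linear V' -> W}) k U (f : V -> V') :
  open U -> continuous l -> Ck k U f -> Ck k U (fun y => l (f y)).
Proof.
move=> oU cl; elim: k f => [|k IH] f fk.
  by move=> x Ux; apply: continuous_comp; [exact: fk|exact: cl].
have [df dfk] := CkSP fk.
apply: (CkS_ext oU) => [x Ux|v].
  by apply: differentiable_comp; [exact: df|exact: linear_differentiable].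
exists (fun y => l ('d f y v)); first exact: IH (dfk v).
by move=> x Ux; rewrite -(diff_lincomp _ cl)//; exact: df.
Qed.

Lemma Ck_entry m n k U (f : V -> 'M[R]_(m, n)) i j : open U ->
  Ck k U f -> Ck k U (fun y => f y i j).
Proof.
by move=> oU; exact: (@Ck_lincomp _ _ (entry i j)) oU (@coord_continuous _ _ _ i j).
Qed.

Lemma Ck_mx m n k U (f : V -> 'M[R]_(m, n)) : open U ->
  (forall i j, Ck k U (fun y => f y i j)) -> Ck k U f.
Proof.
move=> oU; elim: k f => [|k IH] f fk.
  have fE : f = fun y => \sum_i \sum_j f y i j *: delta_mx i j.
    by apply/funext => y; exact: matrix_sum_delta.
  suff : Ck 0 U (fun y => \sum_i \sum_j f y i j *: delta_mx i j) by rewrite -fE.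
  apply: (Ck_sum oU) => // i; apply: (Ck_sum oU) => j y Uy.
  by apply: continuousZr_tmp; exact: fk.
have df x : U x -> differentiable f x.
  by move=> Ux; apply: differentiable_mx => i j; have [+ _] := CkSP (fk i j); exact.
apply: (CkS_ext oU) => [//|v].
exists (fun y => 'd f y v) => //; apply: IH => i j.
have [_ /(_ v)] := CkSP (fk i j); apply: (Ck_ext oU) => y Uy.
by rewrite diff_entry//; exact: df.
Qed.

End Calculus.

(** [Ck] differentiates in fixed directions only, while the chain rule feeds the moving direction
    ['d f y v] to ['d g (f y)]. Expanding it in the standard basis leaves fixed directions with C^k
    coefficients; this is why the middle space consists of rows. *)
Lemma Ck_comp (R : realType) (V : normedModType R) p m n k (U : set V)
    (U' : set 'rV[R]_p) (f : V -> 'rV[R]_p) (g : 'rV[R]_p -> 'M[R]_(m, n)) :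
  open U -> (forall x, U x -> U' (f x)) ->
  Ck k U f -> Ck k U' g -> Ck k U (g \o f).
Proof.
move=> oU fU; elim: k g => [|k IH] g fk gk.
  by move=> x Ux; apply: continuous_comp; [exact: fk|apply: gk; exact: fU].
have [[df dfk] [dg dgk]] := (CkSP fk, CkSP gk).
have gfk := IH _ (CkW fk).
apply: (CkS_ext oU) => [x Ux|v].
  by apply: differentiable_comp; [exact: df|apply: dg; exact: fU].
exists (fun y => \sum_i 'd f y v 0 i *: 'd g (f y) (delta_mx 0 i)).
  apply: (Ck_sum oU) => i; apply: (Ck_mx oU) => a b.
  apply: (@Ck_ext _ _ _ _ _
    (fun y => 'd f y v 0 i * 'd g (f y) (delta_mx 0 i) a b)) => //.
    by move=> x _; rewrite mxE.
  apply: (CkM oU); first by apply: (Ck_entry _ _ oU); exact: dfk.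
  by apply: (Ck_entry _ _ oU); exact: gfk (dgk (delta_mx 0 i)).
move=> x Ux; apply: esym.
have /(congr1 (fun h : V -> 'M[R]_(m, n) => h v)) E :=
  diff_comp (df x Ux) (dg _ (fU _ Ux)).
apply: etrans E _; rewrite /= [in LHS](row_sum_delta ('d f x v)) linear_sum.
by apply: eq_bigr => i _; rewrite linearZ.
Qed.

Section Smooth.
Context {R : realType} {V : normedModType R}.
Implicit Types (W : normedModType R) (U : set V).

Lemma smooth_differentiable W U (f : V -> W) x :
  smooth_on U f -> U x -> differentiable f x.
Proof. by move=> [_ /(_ 1%N)] [df _] /df. Qed.

Lemma smooth_subset W U U' (f : V -> W) :
  open U' -> U' `<=` U -> smooth_on U f -> smooth_on U' f.
Proof.
move=> oU' sU [oU fU]; split=> // k; have := fU k; move: {fU} f.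
elim: k => [|k IH] f; first by move=> fk x /sU; exact: fk.
by move=> [df dfk]; split=> [x /sU|v]; [exact: df|exact: IH (dfk v)].
Qed.

Lemma smooth_ext W U (f g : V -> W) : (forall x, U x -> f x = g x) ->
  smooth_on U f -> smooth_on U g.
Proof. by move=> fg [oU fU]; split=> // k; exact: Ck_ext fg (fU k). Qed.

Lemma smooth_cst W U (a : W) : open U -> smooth_on U (fun _ : V => a).
Proof. by move=> oU; split=> // k; exact: Ck_cst. Qed.

Lemma smoothD W U (f g : V -> W) : smooth_on U f -> smooth_on U g ->
  smooth_on U (fun y => f y + g y).
Proof. by move=> [oU fU] [_ gU]; split=> // k; exact: CkD. Qed.

Lemma smooth_sum W U (I : finType) (f : I -> V -> W) : open U ->
  (forall i, smooth_on U (f i)) -> smooth_on U (fun y => \sum_i f i y).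
Proof.
by move=> oU fU; split=> // k; apply: Ck_sum => // i; have [_] := fU i; exact.
Qed.

Lemma smoothM U (f g : V -> R) : smooth_on U f -> smooth_on U g ->
  smooth_on U (fun y => f y * g y).
Proof. by move=> [oU fU] [_ gU]; split=> // k; exact: CkM. Qed.

Lemma smoothN U (f : V -> R) : smooth_on U f -> smooth_on U (fun y => - f y).
Proof. by move=> [oU fU]; split=> // k; exact: CkN. Qed.

Lemma smoothB U (f g : V -> R) : smooth_on U f -> smooth_on U g ->
  smooth_on U (fun y => f y - g y).
Proof. by move=> fU gU; apply: smoothD => //; exact: smoothN. Qed.

Lemma smoothV U (f : V -> R) : (forall x, U x -> f x != 0) -> smooth_on U f ->
  smooth_on U (fun y => (f y)^-1).
Proof. by move=> f0 [oU fU]; split=> // k; exact: CkV. Qed.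

Lemma smooth_sqrt U (f : V -> R) : (forall x, U x -> 0 < f x) -> smooth_on U f ->
  smooth_on U (fun y => Num.sqrt (f y)).
Proof. by move=> f0 [oU fU]; split=> // k; exact: Ck_sqrt. Qed.

Lemma smooth_mx m n U (f : V -> 'M[R]_(m, n)) : open U ->
  (forall i j, smooth_on U (fun y => f y i j)) -> smooth_on U f.
Proof.
by move=> oU fU; split=> // k; apply: Ck_mx => // i j; have [_] := fU i j; exact.
Qed.

Lemma smooth_entry m n U (f : V -> 'M[R]_(m, n)) i j :
  smooth_on U f -> smooth_on U (fun y => f y i j).
Proof. by move=> [oU fU]; split=> // k; exact: Ck_entry. Qed.

Lemma smooth_comp p m n U (U' : set 'rV[R]_p) (f : V -> 'rV[R]_p)
    (g : 'rV[R]_p -> 'M[R]_(m, n)) : (forall x, U x -> U' (f x)) ->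
  smooth_on U f -> smooth_on U' g -> smooth_on U (g \o f).
Proof.
by move=> fU [oU fk] [oU' gk]; split=> // k; exact: Ck_comp fU (fk k) (gk k).
Qed.

Lemma smooth_d W U (f : V -> W) v :
  smooth_on U f -> smooth_on U (fun y => 'd f y v).
Proof.
by move=> [oU fU]; split=> // k; have [_] := CkSP (fU k.+1); exact.
Qed.

Lemma smooth_mulmx m n p U (f : V -> 'M[R]_(m, n)) (g : V -> 'M[R]_(n, p)) :
  smooth_on U f -> smooth_on U g -> smooth_on U (fun y => f y *m g y).
Proof.
move=> fU gU; have oU : open U by case: fU.
apply: smooth_mx => // i j.
apply: (@smooth_ext _ _ (fun y => \sum_l f y i l * g y l j)).
  by move=> x _; rewrite mxE.
by apply: smooth_sum => // l; apply: smoothM; exact: smooth_entry.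
Qed.

Lemma smooth_tr m n U (f : V -> 'M[R]_(m, n)) :
  smooth_on U f -> smooth_on U (fun y => (f y)^T).
Proof.
move=> fU; have oU : open U by case: fU.
apply: smooth_mx => // i j; apply: (@smooth_ext _ _ (fun y => f y j i)).
  by move=> x _; rewrite mxE.
exact: smooth_entry.
Qed.

Lemma smoothZ m n U (f : V -> R) (g : V -> 'M[R]_(m, n)) :
  smooth_on U f -> smooth_on U g -> smooth_on U (fun y => f y *: g y).
Proof.
move=> fU gU; have oU : open U by case: fU.
apply: smooth_mx => // i j; apply: (@smooth_ext _ _ (fun y => f y * g y i j)).
  by move=> x _; rewrite mxE.
by apply: smoothM => //; exact: smooth_entry.
Qed.

Lemma smooth_mxN m n U (f : V -> 'M[R]_(m, n)) :
  smooth_on U f -> smooth_on U (fun y => - f y).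
Proof.
move=> fU; have oU : open U by case: fU.
apply: smooth_mx => // i j; apply: (@smooth_ext _ _ (fun y => - f y i j)).
  by move=> x _; rewrite mxE.
by apply: smoothN; exact: smooth_entry.
Qed.

Lemma smooth_id U : open U -> smooth_on U (id : V -> V).
Proof.
move=> oU; split=> // k; apply: (@Ck_linear _ _ _ _ _ idfun) => //.
by move=> x; exact: cvg_id.
Qed.

Lemma diff_addE W (f g : V -> W) x v :
  differentiable f x -> differentiable g x ->
  'd (fun y => f y + g y) x v = 'd f x v + 'd g x v.
Proof. by move=> df dg; have /(congr1 (fun h : V -> W => h v)) := diffD df dg. Qed.

Lemma diff_cstE W (a : W) (x v : V) : 'd (fun _ : V => a) x v = 0.
Proof. by have /(congr1 (fun h : V -> W => h v)) := diff_cst a x. Qed.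

Lemma diff_scaleE W (f : V -> R) (a : W) x v : differentiable f x ->
  'd (fun y => f y *: a) x v = 'd f x v *: a.
Proof. by move=> df; have /(congr1 (fun h : V -> W => h v)) := diffZl a df. Qed.

Lemma diff_idE (x v : V) : 'd (id : V -> V) x v = v.
Proof.
have c : continuous (idfun : {linear V -> V}) by move=> y; exact: cvg_id.
by have /(congr1 (fun h : V -> V => h v)) := diff_lin x c.
Qed.

Lemma diff_mulmx m n p (f : V -> 'M[R]_(m, n)) (g : V -> 'M[R]_(n, p)) x v :
  differentiable f x -> differentiable g x ->
  differentiable (fun y => f y *m g y) x /\
  'd (fun y => f y *m g y) x v = 'd f x v *m g x + f x *m 'd g x v.
Proof.
move=> df dg.
have dfe i j : differentiable (fun y => f y i j) x by exact: differentiable_entry.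
have dge i j : differentiable (fun y => g y i j) x by exact: differentiable_entry.
have E i j : (fun y => (f y *m g y) i j) = fun y => \sum_l f y i l * g y l j.
  by apply/funext => y; rewrite mxE.
have dM i j l : differentiable (fun y => f y i l * g y l j) x.
  exact: (@differentiableM _ _ (fun y => f y i l) (fun y => g y l j)).
have d : differentiable (fun y => f y *m g y) x.
  by apply: differentiable_mx => i j; rewrite E; exact: differentiable_sumf.
split=> //; apply/matrixP => i j; rewrite -diff_entry// E diff_sumf//.
rewrite !mxE -big_split; apply: eq_bigr => l _ /=.
by rewrite diff_mulr// !diff_entry.
Qed.

Lemma diff_scalemx m n (f : V -> R) (g : V -> 'M[R]_(m, n)) x v :
  differentiable f x -> differentiable g x ->
  'd (fun y => f y *: g y) x v = 'd f x v *: g x + f x *: 'd g x v.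
Proof.
move=> df dg.
have dge i j : differentiable (fun y => g y i j) x by exact: differentiable_entry.
have E i j : (fun y => (f y *: g y) i j) = fun y => f y * g y i j.
  by apply/funext => y; rewrite mxE.
have d : differentiable (fun y => f y *: g y) x.
  apply: differentiable_mx => i j; rewrite E.
  exact: (@differentiableM _ _ f (fun y => g y i j)).
apply/matrixP => i j; rewrite -diff_entry// E.
by rewrite diff_mulr// diff_entry// !mxE.
Qed.

Lemma diff_trmx m n (f : V -> 'M[R]_(m, n)) x v : differentiable f x ->
  differentiable (fun y => (f y)^T) x /\
  'd (fun y => (f y)^T) x v = ('d f x v)^T.
Proof.
move=> df.
have E i j : (fun y => (f y)^T i j) = fun y => f y j i.
  by apply/funext => y; rewrite mxE.
have d : differentiable (fun y => (f y)^T) x.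
  by apply: differentiable_mx => i j; rewrite E; exact: differentiable_entry.
split=> //; apply/matrixP => i j.
by rewrite -diff_entry// E diff_entry// mxE.
Qed.

End Smooth.

Lemma diff_line (R : realType) (V : normedModType R) (a e : V) (t : R) :
  'd (fun s : R => a + s *: e) t 1 = e.
Proof.
have di : differentiable (fun s : R => s) t.
  exact: (@ex_diff _ _ _ _ _ _ _ (is_diff_id t)).
have dc : differentiable (fun _ : R => a) t by exact: differentiable_cst.
have ds : differentiable (fun s : R => s *: e) t by exact: differentiableZl.
have E := diff_addE (1 : R) dc ds; apply: (etrans E).
have {}E := diff_cstE a t (1 : R); rewrite E add0r.
have {}E := diff_scaleE e (1 : R) di; apply: (etrans E).
have {}E := diff_idE t (1 : R); by rewrite E scale1r.
Qed.

(** The moving direction [X y] is again expanded in the standard basis. *)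
Lemma smooth_d_along (R : realType) (V : normedModType R) p m n (U : set V)
    (U' : set 'rV[R]_p) (f : V -> 'rV[R]_p) (Y : 'rV[R]_p -> 'M[R]_(m, n))
    (X : V -> 'rV[R]_p) : (forall x, U x -> U' (f x)) ->
  smooth_on U f -> smooth_on U' Y -> smooth_on U X ->
  smooth_on U (fun y => 'd Y (f y) (X y)).
Proof.
move=> fU sf sY sX; have oU : open U by case: sX.
apply: (@smooth_ext _ _ _ _ (fun y => \sum_i X y 0 i *: 'd Y (f y) (delta_mx 0 i))).
  move=> y Uy; rewrite [in RHS](row_sum_delta (X y)) linear_sum.
  by apply: eq_bigr => i _; rewrite linearZ.
apply: smooth_sum => // i; apply: smoothZ; first exact: smooth_entry.
exact: smooth_comp fU sf (smooth_d (delta_mx 0 i) sY).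
Qed.

(** * Tangent vectors and slice charts *)

Section Tangent.
Context {R : realType}.

(** Along a curve of [M] with velocity [v] the maps [F] and [G] coincide, and the chain rule
    computes both differentials from that curve. This is how derivatives of fields are shown to
    depend only on their values on [M]. *)
Lemma tangent_diff_eq n (W : normedModType R) (M : set 'rV[R]_n)
    (F G : 'rV[R]_n -> W) x v : tangent M x v ->
  differentiable F x -> differentiable G x ->
  (\forall y \near x, M y -> F y = G y) -> 'd F x v = 'd G x v.
Proof.
move=> [J [c [cJ J0 cM c0 cv]]] dF dG FG.
have oJ : open J by case: cJ.
have dc : differentiable c 0 by exact: smooth_differentiable cJ J0.
have {}cv : 'd c 0 1 = v by rewrite -cv derive1E'.
have dH (H : 'rV[R]_n -> W) : differentiable H x ->
    differentiable (H \o c) 0 /\ 'd (H \o c) 0 1 = 'd H x v.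
  move=> dH; rewrite -c0 in dH.
  split; first exact: differentiable_comp.
  have /(congr1 (fun h : R -> W => h 1)) E := diff_comp dc dH.
  by apply: etrans E _; rewrite /= cv c0.
have [dFc <-] := dH _ dF; have [dGc <-] := dH _ dG.
apply: diff_near_eq dFc.
have cc : {for 0, continuous c} by exact: differentiable_continuous.
have FGc : \forall t \near 0, M (c t) -> F (c t) = G (c t).
  by rewrite -c0 in FG; exact: cc FG.
near=> t; have cMt : M (c t) by apply: cM; near: t; exact: open_nbhs_nbhs.
by apply: (near FGc t).
Unshelve. all: by end_near. Qed.

Lemma tangent_map k n (M : set 'rV[R]_k) (N : set 'rV[R]_n)
    (U : set 'rV[R]_k) (phi : 'rV[R]_k -> 'rV[R]_n) x v :
  smooth_on U phi -> M `<=` U -> (forall y, M y -> N (phi y)) ->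
  tangent M x v -> tangent N (phi x) ('d phi x v).
Proof.
move=> phiU MU MN [J [c [cJ J0 cM c0 cv]]].
have dc : differentiable c 0 by exact: smooth_differentiable cJ J0.
have dphi : differentiable phi (c 0).
  by apply: smooth_differentiable phiU _; apply: MU; exact: cM.
have phicJ : smooth_on J (phi \o c).
  by apply: smooth_comp cJ phiU => t /cM/MU.
exists J, (phi \o c); split=> //; first by move=> t /cM/MN.
  by rewrite /= c0.
rewrite derive1E'; last exact: smooth_differentiable phicJ J0.
have /(congr1 (fun h : R -> 'rV[R]_n => h 1)) E := diff_comp dc dphi.
by apply: etrans E _; rewrite /= -derive1E'// cv c0.
Qed.

Lemma diffeomorphism_sym n (U V : set 'rV[R]_n) Phi Psi :
  diffeomorphism U V Phi Psi -> diffeomorphism V U Psi Phi.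
Proof. by case=> *; split. Qed.

Lemma diffeomorphism_dK n (U V : set 'rV[R]_n) Phi Psi x v :
  diffeomorphism U V Phi Psi -> U x -> 'd Psi (Phi x) ('d Phi x v) = v.
Proof.
move=> [PhiU PsiV UV VU] Ux.
have oU : open U by case: PhiU.
have dPhi : differentiable Phi x by exact: smooth_differentiable PhiU Ux.
have dPsi : differentiable Psi (Phi x).
  by apply: smooth_differentiable PsiV _; have [] := UV _ Ux.
have /(congr1 (fun h : 'rV[R]_n -> 'rV[R]_n => h v)) E := diff_comp dPhi dPsi.
apply: etrans (esym E) _.
rewrite -[RHS](@diff_idE _ _ x v).
apply: diff_near_eq; last exact: differentiable_comp.
near=> y; have [|_ //] := UV y; near: y; exact: open_nbhs_nbhs.
Unshelve. all: by end_near. Qed.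

(** The last coordinates of [Phi] vanish on [M], hence so do their derivatives in tangent
    directions. Conversely, [Psi] carries the straight line through [Phi x] in the direction
    ['d Phi x v] to a curve of [M] with velocity [v]. *)
Lemma slice_tangent n d (M U V : set 'rV[R]_n) Phi Psi x v :
  diffeomorphism U V Phi Psi -> U x -> M x ->
  (forall y, U y -> (M y <-> forall i : 'I_n, (d <= i)%N -> Phi y 0 i = 0)) ->
  (tangent M x v <-> forall i : 'I_n, (d <= i)%N -> 'd Phi x v 0 i = 0).
Proof.
move=> dPhi Ux Mx slice; have [PhiU PsiV UV VU] := dPhi.
have oU : open U by case: PhiU.
have dPhix : differentiable Phi x by exact: smooth_differentiable PhiU Ux.
have [Vx xK] := UV _ Ux.
split=> [xv i di|e0].
  have dc : differentiable (fun=> 0 : R) x by exact: differentiable_cst.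
  rewrite -diff_entry//.
  rewrite (tangent_diff_eq xv (differentiable_entry 0 i dPhix) dc); last first.
    near=> y => My; apply: (slice y _).1 => //; near: y.
    exact: open_nbhs_nbhs.
  by rewrite (diff_cst (0 : R)).
pose l (t : R) := Phi x + t *: 'd Phi x v.
have lS : smooth_on setT l.
  apply: smoothD; first by apply: smooth_cst; exact: openT.
  apply: (@smoothZ _ _ _ _ _ (fun t => t) (fun=> 'd Phi x v)).
    by apply: smooth_id; exact: openT.
  by apply: smooth_cst; exact: openT.
have l0 : l 0 = Phi x by rewrite /l scale0r addr0.
have lc : continuous l.
  by move=> t; apply: differentiable_continuous; exact: smooth_differentiable lS _.
pose J := l @^-1` V.
have oJ : open J by apply: open_comp => [t _|]; [exact: lc|case: PsiV].
have cJ : smooth_on J (Psi \o l).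
  apply: (@smooth_comp _ _ _ _ _ J V) => //.
  exact: smooth_subset oJ _ lS.
exists J, (Psi \o l); split=> //.
- by rewrite /J /= l0.
- move=> t Jt; have [Ut Kt] := VU _ Jt; apply/(slice _ Ut) => i di.
  rewrite /= Kt /l !mxE e0// mulr0 addr0.
  exact: (slice x Ux).1.
- by rewrite /= l0.
have J0 : J 0 by rewrite /J /= l0.
rewrite derive1E'; last exact: smooth_differentiable cJ _.
have dl : differentiable l 0 by exact: smooth_differentiable lS _.
have dPsi : differentiable Psi (l 0) by rewrite l0; exact: smooth_differentiable PsiV _.
have /(congr1 (fun h : R -> 'rV[R]_n => h 1)) E := diff_comp dl dPsi.
apply: etrans E _; rewrite /= l0.
suff -> : 'd l 0 1 = 'd Phi x v by exact: diffeomorphism_dK dPhi Ux.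
exact: diff_line.
Unshelve. all: by end_near. Qed.

End Tangent.

(** * Quadrics and their Levi-Civita connection *)

(** Forms are given by Gram matrices so that kernels, ranks and smoothness become statements about
    matrix products. *)
Definition qf (R : realType) n (S : 'M[R]_n) : Defs.form R n :=
  fun x y => (x *m S *m y^T) 0 0.

Section QuadraticForm.
Context {R : realType} {n : nat} (S : 'M[R]_n).
Implicit Types x y z : 'rV[R]_n.

Lemma qfDl x y z : qf S (x + y) z = qf S x z + qf S y z.
Proof. by rewrite /qf !mulmxDl mxE. Qed.

Lemma qfDr x y z : qf S z (x + y) = qf S z x + qf S z y.
Proof. by rewrite /qf linearD mulmxDr mxE. Qed.

Lemma qfZl a x y : qf S (a *: x) y = a * qf S x y.
Proof. by rewrite /qf -!scalemxAl mxE. Qed.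

Lemma qfZr a x y : qf S x (a *: y) = a * qf S x y.
Proof. by rewrite /qf linearZ -scalemxAr mxE. Qed.

Lemma qfNl x y : qf S (- x) y = - qf S x y.
Proof. by rewrite -scaleN1r qfZl mulN1r. Qed.

Lemma qfNr x y : qf S x (- y) = - qf S x y.
Proof. by rewrite -scaleN1r qfZr mulN1r. Qed.

Lemma qf0l x : qf S 0 x = 0.
Proof. by rewrite -(scale0r 0) qfZl mul0r. Qed.

Lemma qf0r x : qf S x 0 = 0.
Proof. by rewrite -(scale0r 0) qfZr mul0r. Qed.

Lemma qf_sumr (I : finType) (f : I -> 'rV[R]_n) y :
  qf S y (\sum_i f i) = \sum_i qf S y (f i).
Proof.
by elim/big_rec2 : _ => [|i a b _ <-]; rewrite ?qf0r// qfDr.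
Qed.

Definition qfE := (qfDl, qfDr, qfZl, qfZr, qfNl, qfNr).

Lemma qfC x y : S^T = S -> qf S x y = qf S y x.
Proof.
by move=> ST; rewrite /qf -[in LHS](trmxK (_ *m _)) mxE !trmx_mul trmxK ST mulmxA.
Qed.

Lemma smooth_qf (V : normedModType R) U (f g : V -> 'rV[R]_n) :
  smooth_on U f -> smooth_on U g -> smooth_on U (fun t => qf S (f t) (g t)).
Proof.
move=> fU gU; have oU : open U by case: fU.
apply: (@smooth_entry _ _ _ _ _ (fun t => f t *m S *m (g t)^T)).
apply: smooth_mulmx; last exact: smooth_tr.
by apply: smooth_mulmx => //; exact: smooth_cst.
Qed.

Lemma diff_qf (V : normedModType R) (f g : V -> 'rV[R]_n) p v :
  differentiable f p -> differentiable g p ->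
  differentiable (fun t => qf S (f t) (g t)) p /\
  'd (fun t => qf S (f t) (g t)) p v = qf S ('d f p v) (g p) + qf S (f p) ('d g p v).
Proof.
move=> df dg.
have dS : differentiable (fun _ : V => S) p by exact: differentiable_cst.
have [d1 E1] := diff_mulmx v df dS.
have [d2 E2] := diff_trmx v dg.
have [d3 E3] := diff_mulmx v d1 d2.
split; first exact: (@differentiable_entry _ _ _ _ _ p 0 0 d3).
have E := diff_entry v 0 0 d3; apply: (etrans E).
have {}E1 := etrans E1 (congr1 (fun A => _ + f p *m A) (diff_cstE S p v)).
suff H a b c : a = 'd f p v *m S + f p *m 0 -> b = ('d g p v)^T ->
    c = a *m (g p)^T + f p *m S *m b ->
    c 0 0 = qf S ('d f p v) (g p) + qf S (f p) ('d g p v) by exact: H E1 E2 E3.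
by move=> -> -> ->; rewrite mulmx0 addr0 mxE.
Qed.

End QuadraticForm.

(** The first condition discards the singular points of the equation. For [K != 0] it follows from
    the second; for [K = 0] it removes the vertex of a cone, or the kernel of a degenerate [S]. *)
Definition quadric (R : realType) n (S : 'M[R]_n) (K : R) : set 'rV[R]_n :=
  [set z | z *m S != 0 /\ qf S z z = K].

(* The multiple of the Euclidean gradient on which the form [qf S z] is 1. *)
Definition conormal (R : realType) n (S : 'M[R]_n) (z : 'rV[R]_n) : 'rV[R]_n :=
  (qf 1%:M (z *m S) (z *m S))^-1 *: (z *m S).

Section Quadric.
Context {R : realType}.

Lemma qf1_eq0 n (x : 'rV[R]_n) : (qf 1%:M x x == 0) = (x == 0).
Proof.
apply/idP/eqP => [|->]; last by rewrite qf0l.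
rewrite /qf mulmx1 mxE => /eqP h; apply/rowP => i; rewrite mxE.
have := psumr_eq0P _ h => /(_ (fun j _ => _)) h'.
have {}h' : x 0 i * x^T i 0 = 0 by apply: h' => // j; rewrite mxE -expr2 sqr_ge0.
by move: h'; rewrite mxE => /eqP; rewrite mulf_eq0 orbb => /eqP.
Qed.

Lemma qf1_gt0 n (x : 'rV[R]_n) : (0 < qf 1%:M x x) = (x != 0).
Proof.
rewrite lt0r qf1_eq0 /qf mulmx1 mxE sumr_ge0 ?andbT// => i _.
by rewrite mxE -expr2 sqr_ge0.
Qed.

Lemma open_positive (V : normedModType R) (g : V -> R) :
  smooth_on setT g -> open [set y | 0 < g y].
Proof.
move=> gT; apply: (@open_comp _ _ g [set t | 0 < t]); last exact: open_gt.
by move=> y _; apply: differentiable_continuous; exact: smooth_differentiable gT _.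
Qed.

Lemma qf_conormal n (S : 'M[R]_n) z : z *m S != 0 -> qf S z (conormal S z) = 1.
Proof.
move=> zS; rewrite qfZr /qf mulmx1 mulVf//.
by have := qf1_eq0 (z *m S); rewrite /qf mulmx1 => ->.
Qed.

Lemma smooth_conormal n (S : 'M[R]_n) : smooth_on [set z | z *m S != 0] (conormal S).
Proof.
have smS : smooth_on setT (fun z : 'rV[R]_n => z *m S).
  by apply: smooth_mulmx; [apply: smooth_id|apply: smooth_cst]; exact: openT.
have smq : smooth_on setT (fun z : 'rV[R]_n => qf 1%:M (z *m S) (z *m S)).
  exact: smooth_qf.
have oU : open [set z : 'rV[R]_n | z *m S != 0].
  rewrite (_ : [set _ | _] = [set z | 0 < qf 1%:M (z *m S) (z *m S)]).
    exact: open_positive.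
  by apply/seteqP; split=> z /=; rewrite qf1_gt0.
apply: smoothZ; last exact: smooth_subset smS.
by apply: smoothV; [move=> z /=; rewrite qf1_eq0|exact: smooth_subset smq].
Qed.

(** A nonzero linear form is the last coordinate of some linear coordinate system. The chart below
    applies it to the form [qf S z]. *)
Lemma complete_row n (w : 'rV[R]_n.+1) : w != 0 ->
  exists2 T, T \in unitmx & forall y : 'rV_n.+1, (y *m T) 0 ord_max = (y *m w^T) 0 0.
Proof.
move=> w0; pose U : 'rV[R]_n.+1 := delta_mx 0 ord_max.
have UU : U *m U^T = 1%:M.
  rewrite trmx_delta mul_delta_mx; apply/matrixP => i j.
  by rewrite !ord1 !mxE.
have Uf : U *m (U^T *m w) = w by rewrite mulmxA UU mul1mx.
have [|g gu] := @complete_unitmx _ _ _ U (U^T *m w).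
  rewrite Uf !rank_rV w0; congr nat_of_bool; apply/esym/eqP => U0.
  move: UU; rewrite U0 mul0mx => /matrixP/(_ 0 0); rewrite !mxE => /eqP.
  by rewrite eq_sym oner_eq0.
rewrite Uf => wE; exists g^T; first by rewrite unitmx_tr.
move=> y; rewrite wE trmx_mul mulmxA [RHS]mxE.
rewrite (bigD1 ord_max)//= big1 ?addr0 => [|i ni]; rewrite !mxE ?eqxx ?mulr1//.
by rewrite (negbTE ni) mulr0.
Qed.

(** The discriminant is the square of [b + s * e]. The root is written with the square root in the
    denominator because the usual formula divides by [e], and [e] is zero when the transversal
    direction is null. *)
Lemma quadratic_root (b s e c : R) : 0 < b -> 0 < b + s * e ->
  let f := c + 2 * s * b + s ^+ 2 * e in
  [/\ 0 < b ^+ 2 + e * (f - c) & (f - c) / (b + Num.sqrt (b ^+ 2 + e * (f - c))) = s].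
Proof.
move=> b0 bs0 f; have -> : b ^+ 2 + e * (f - c) = (b + s * e) ^+ 2 by rewrite /f; ring.
split; first by rewrite exprn_gt0.
rewrite sqrtr_sqr gtr0_norm// /f.
have h : b + (b + s * e) != 0 by rewrite gt_eqF// addr_gt0.
by field.
Qed.

(** With [q] the square root of the discriminant, [(q - b) * (q + b) = e * (f - c)] gives
    [s * e = q - b]. *)
Lemma quadratic_root_inv (b f e c : R) : 0 < b -> 0 < b ^+ 2 + e * (f - c) ->
  let s := (f - c) / (b + Num.sqrt (b ^+ 2 + e * (f - c))) in
  0 < b + s * e /\ c + 2 * s * b + s ^+ 2 * e = f.
Proof.
move=> b0; set D := _ + _ => D0 s.
have q0 : 0 < Num.sqrt D by rewrite sqrtr_gt0.
have q2 : Num.sqrt D ^+ 2 = b ^+ 2 + e * (f - c) by rewrite sqr_sqrtr// ltW.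
have h : b + Num.sqrt D != 0 by rewrite gt_eqF// addr_gt0.
have sE : s * (b + Num.sqrt D) = f - c by rewrite /s divfK.
have se : s * e = Num.sqrt D - b.
  apply: (mulIf h); rewrite mulrAC sE mulrC.
  have -> : (Num.sqrt D - b) * (b + Num.sqrt D) = Num.sqrt D ^+ 2 - b ^+ 2 by ring.
  by rewrite q2; ring.
rewrite se addrC subrK; split=> //.
have -> : c + 2 * s * b + s ^+ 2 * e = c + s * (2 * b + s * e) by ring.
rewrite se; have -> : 2 * b + (Num.sqrt D - b) = b + Num.sqrt D by ring.
by rewrite sE addrC subrK.
Qed.

(** The chart keeps the component of [y] in the kernel of [qf S z] and replaces the coordinate along
    [u] by the value of the equation. The old coordinate is recovered as the root of a quadratic
    polynomial, so the inverse is explicit and smooth. *)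
Lemma quadric_chart n (S : 'M[R]_n.+1) K z : S^T = S -> quadric S K z ->
  exists U V Phi Psi, [/\ diffeomorphism U V Phi Psi, U z,
    forall y, U y -> (quadric S K y <-> Phi y 0 ord_max = 0) &
    forall y, Phi y 0 ord_max = qf S y y - K].
Proof.
move=> ST [zS zK].
move: (conormal S z) (qf_conormal zS) => u zu; pose e := qf S u u.
have uz : qf S u z = 1 by rewrite qfC.
pose p (y : 'rV[R]_n.+1) := y - qf S z y *: u.
have zp y : qf S z (p y) = 0 by rewrite /p !qfE zu mulr1 subrr.
have pK x a : qf S z x = 0 -> p (x + a *: u) = x.
  by move=> zx; rewrite /p !qfE zx zu mulr1 add0r addrK.
(* Here [y = z + h y + s y *: u]. On each line parallel to [u] the function [F] is a quadratic
   polynomial in [s], with coefficients [c (h y)], [2 * b (h y)] and [e]. *)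
pose s y := qf S z (y - z); pose h y := p (y - z).
pose b y := 1 + qf S y u; pose c y := qf S y y.
pose F y := qf S y y - K.
have yE y : y = z + h y + s y *: u by rewrite /h /p -/(s y) addrA subrK addrC subrK.
have FE y : F y = c (h y) + 2 * s y * b (h y) + s y ^+ 2 * e.
  have zH : qf S z (h y) = 0 by exact: zp.
  rewrite /F [in qf S y y](yE y); move: (h y) (s y) zH => H t zH.
  rewrite !qfE zK zu uz (qfC H z ST) zH (qfC u H ST) /c /b /e; ring.
have bE y : qf S y u = b (h y) + s y * e.
  by rewrite {1}(yE y); move: (h y) (s y) => H t; rewrite !qfE zu /b /e.
have [T Tu TE] := complete_row zS.
have TS y : (y *m T) 0 ord_max = qf S z y.
  by rewrite TE qfC// /qf trmx_mul ST mulmxA.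
pose Phi y := (h y + F y *: u) *m T.
have PhiE y : Phi y 0 ord_max = F y.
  by rewrite TS qfDr zp qfZr zu mulr1 add0r.
pose f w := qf S z (w *m invmx T).
pose k w := p (w *m invmx T).
pose D w := b (k w) ^+ 2 + e * (f w - c (k w)).
pose r w := (f w - c (k w)) / (b (k w) + Num.sqrt (D w)).
pose Psi w := z + k w + r w *: u.
(* The quantity [b + s * e] is half the derivative of [F] along [u], and [D] becomes its square. At
   [z] both positivity conditions read [0 < 1]; nearby they single out the root that is 0 at [z]. *)
pose U := [set y | 0 < b (h y)] `&` [set y | 0 < b (h y) + s y * e].
pose V := [set w | 0 < b (k w)] `&` [set w | 0 < D w].
have oT := @openT.
have cst (W : normedModType R) (a : W) :
  smooth_on setT (fun _ : 'rV[R]_n.+1 => a) by exact: smooth_cst.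
have sid : smooth_on setT (fun y : 'rV[R]_n.+1 => y) by exact: smooth_id.
have sp g : smooth_on setT g -> smooth_on setT (fun y : 'rV[R]_n.+1 => p (g y)).
  move=> gT; apply: smoothD => //; apply: smooth_mxN; apply: smoothZ => //.
  exact: smooth_qf.
have sc g : smooth_on setT g -> smooth_on setT (fun y : 'rV[R]_n.+1 => c (g y)).
  by move=> gT; exact: smooth_qf.
have sb g : smooth_on setT g -> smooth_on setT (fun y : 'rV[R]_n.+1 => b (g y)).
  by move=> gT; apply: smoothD => //; exact: smooth_qf.
have sz : smooth_on setT (fun y => y - z) by exact: smoothD.
have sh : smooth_on setT h by exact: sp.
have ss : smooth_on setT s by exact: smooth_qf.
have sF : smooth_on setT F by apply: smoothB => //; exact: smooth_qf.
have sPhi : smooth_on setT Phi.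
  by apply: smooth_mulmx => //; apply: smoothD => //; exact: smoothZ.
have sT : smooth_on setT (fun w : 'rV[R]_n.+1 => w *m invmx T) by exact: smooth_mulmx.
have sk : smooth_on setT k by exact: sp.
have sf : smooth_on setT f by exact: smooth_qf.
have sD : smooth_on setT D.
  apply: smoothD; first by apply: (@smoothM _ _ _ (fun w => b (k w))); exact: sb.
  by apply: smoothM => //; apply: smoothB => //; exact: sc.
have oU : open U.
  apply: openI; apply: open_positive; first exact: sb.
  by apply: smoothD; [exact: sb|exact: smoothM].
have oV : open V by apply: openI; apply: open_positive => //; exact: sb.
(* On [U] the number [qf S y u] is positive, so the regularity condition of [quadric] holds there
   and membership reduces to [F y = 0]. *)
have bU y : U y -> y *m S != 0.
  move=> [_ /= bs]; apply/negP => /eqP yS.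
  move: bs; rewrite lt_neqAle => /andP[/eqP + _]; apply.
  by rewrite -bE /qf yS mul0mx mxE.
exists U, V, Phi, Psi; split.
- split.
  + exact: smooth_subset sPhi.
  + have sub (W : normedModType R) (g : _ -> W) : smooth_on setT g -> smooth_on V g.
      by move=> gT; exact: smooth_subset gT.
    apply: smoothD; first by apply: sub; exact: smoothD.
    apply: smoothZ; last exact: sub.
    apply: smoothM; first by apply: sub; apply: smoothB => //; exact: sc.
    apply: smoothV => [w [/= b0 D0]|].
      by rewrite gt_eqF// addr_gt0// sqrtr_gt0.
    apply: smoothD; first by apply: sub; exact: sb.
    by apply: smooth_sqrt => [w [_ //]|]; exact: sub.
  + move=> y [/= b0 bs0].
    have Ty : Phi y *m invmx T = h y + F y *: u by rewrite /Phi mulmxK.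
    have fE : f (Phi y) = F y by rewrite /f Ty qfDr zp qfZr zu mulr1 add0r.
    have kE : k (Phi y) = h y by rewrite /k Ty pK// /h zp.
    have [D0 rE] := quadratic_root (c (h y)) b0 bs0.
    split; first by split; rewrite /= /D kE ?fE ?FE.
    by rewrite /Psi kE /r /D kE fE FE rE -yE.
  + move=> w [/= b0 D0].
    have [bs0 FrE] := quadratic_root_inv b0 D0.
    have Pz : Psi w - z = k w + r w *: u by rewrite /Psi addrC !addrA addNr add0r.
    have sE : s (Psi w) = r w by rewrite /s Pz qfDr zp qfZr zu mulr1 add0r.
    have hE : h (Psi w) = k w by rewrite /h Pz pK// /k zp.
    split; first by split; rewrite /= hE ?sE.
    have -> : Phi (Psi w) = (k w + f w *: u) *m T.
      by rewrite /Phi hE FE hE sE FrE.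
    by rewrite /k /p subrK mulmxKV.
- have h0 : h z = 0 by rewrite /h /p subrr qf0r scale0r subr0.
  by split; rewrite /= h0 /b qf0l addr0 ?/s ?subrr ?qf0r ?mul0r ?addr0 ltr01.
- move=> y Uy; rewrite PhiE; split=> [[_ yK]|/eqP]; first by rewrite /F yK subrr.
  by rewrite subr_eq0 => /eqP; split; first exact: bU.
- exact: PhiE.
Qed.

Lemma last_slice n (w : 'rV[R]_n.+1) :
  (w 0 ord_max = 0) <-> (forall i : 'I_n.+1, (n <= i)%N -> w 0 i = 0).
Proof.
split=> [w0 i ni|]; last by apply.
by rewrite (_ : i = ord_max)//; apply/val_inj/eqP; rewrite eqn_leq -ltnS ltn_ord.
Qed.

Lemma quadric0 (S : 'M[R]_0) K z : ~ quadric S K z.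
Proof. by case=> /eqP z0 _; apply: z0; exact: thinmx0. Qed.

Lemma submanifold_quadric n (S : 'M[R]_n) K : S^T = S ->
  submanifold n.-1 (quadric S K).
Proof.
case: n S => [|n] S ST; split; rewrite ?leq_pred// => z zM.
  by have := quadric0 zM.
have [U [V [Phi [Psi [dPhi Uz slice _]]]]] := quadric_chart ST zM.
exists U, V, Phi, Psi; split=> // y Uy; apply: iff_trans (slice y Uy) _.
exact: last_slice.
Qed.

(** The last coordinate of the chart is [qf S y y - K], and its differential at [z] is twice
    [qf S z]. *)
Lemma tangent_quadric n (S : 'M[R]_n) K z v : S^T = S -> quadric S K z ->
  (tangent (quadric S K) z v <-> qf S z v = 0).
Proof.
case: n S z v => [|n] S z v ST zM; first by have := quadric0 zM.
have [U [V [Phi [Psi [dPhi Uz slice PhiE]]]]] := quadric_chart ST zM.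
have [PhiU _ _ _] := dPhi.
have dPhiz : differentiable Phi z by exact: smooth_differentiable PhiU Uz.
apply: iff_trans (slice_tangent v dPhi Uz zM _) _.
  by move=> y Uy; apply: iff_trans (slice y Uy) _; exact: last_slice.
apply: iff_trans (iff_sym (last_slice _)) _.
have E := diff_entry v 0 ord_max dPhiz.
have {}PhiE : (fun y => Phi y 0 ord_max) = (fun y => qf S y y + - K).
  by apply/funext => y; rewrite PhiE.
have di := @ex_diff _ _ _ _ _ _ _ (is_diff_id z).
have [dq dqE] := diff_qf S v di di.
have dK : differentiable (fun _ : 'rV[R]_n.+1 => - K) z by exact: differentiable_cst.
have E' := etrans (diff_addE v dq dK) (congr2 +%R dqE (diff_cstE (- K) z v)).
rewrite PhiE in E; have {E E'} -> := etrans (esym E) E'.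
have -> := diff_idE z v; rewrite addr0 (qfC v z ST) -mulr2n.
by split=> [/eqP|->]; rewrite ?mul0rn// mulrn_eq0 => /eqP.
Qed.

End Quadric.

Section LeviCivitaQuadric.
Context {R : realType} {n : nat} (G : 'M[R]_n) (K : R).
Hypothesis (GT : G^T = G) (K0 : K != 0).
Hypothesis G_nondeg : forall x, (forall y, qf G x y = 0) -> x = 0.
Let M := quadric G K.

(** Differentiating [qf G y (Y y) = 0] shows that the component of ['d Y x v] along [x] is
    [- K^-1 * qf G v (Y x)]. The second term removes it without mentioning a derivative of [Y]. *)
Definition quadric_connection : connection R n :=
  fun x v Y => 'd Y x v + (K^-1 * qf G v (Y x)) *: x.

Lemma quadric_field_orth U X y : vector_field M U X -> U y -> M y ->
  qf G y (X y) = 0.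
Proof. by move=> [_ tX] Uy My; apply/(tangent_quadric _ GT My); exact: tX. Qed.

Lemma quadric_d_field U Y x v : vector_field M U Y -> U x -> M x ->
  tangent M x v -> qf G x ('d Y x v) = - qf G v (Y x).
Proof.
move=> YU Ux Mx tv; have [sY _] := YU; have oU : open U by case: sY.
have dY := smooth_differentiable sY Ux.
have di := @ex_diff _ _ _ _ _ _ _ (is_diff_id x).
have [dq dqE] := diff_qf G v di dY.
have dc : differentiable (fun _ : 'rV[R]_n => 0 : R) x by exact: differentiable_cst.
have E : 'd (fun t => qf G t (Y t)) x v = 0.
  rewrite -[RHS](diff_cstE (0 : R) x v); apply: tangent_diff_eq tv dq dc _.
  near=> y => My; apply: quadric_field_orth YU _ My; near: y.
  exact: open_nbhs_nbhs.
have {}dqE := etrans dqE (congr1 (fun t => qf G t (Y x) + _) (diff_idE x v)).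
have := etrans (esym dqE) E.
by move/eqP; rewrite addrC addr_eq0 => /eqP.
Unshelve. all: by end_near. Qed.

Lemma quadric_self x : M x -> qf G x x = K.
Proof. by case. Qed.

(** The constant field [v] projected orthogonally to the tangent spaces. It extends any tangent
    vector to a vector field of [M]. *)
Definition quadric_field (v y : 'rV[R]_n) : 'rV[R]_n :=
  v - (K^-1 * qf G y v) *: y.

Lemma vector_field_quadric_field U v : open U -> vector_field M U (quadric_field v).
Proof.
move=> oU; split.
  have sid := smooth_id oU; have scv := smooth_cst v oU.
  apply: smoothD => //; apply: smooth_mxN; apply: smoothZ => //.
  by apply: smoothM; [exact: smooth_cst|exact: smooth_qf].
move=> y Uy My; apply/(tangent_quadric _ GT My).
by rewrite /quadric_field !qfE (quadric_self My) mulrAC mulVf// mul1r subrr.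
Qed.

Lemma quadric_fieldE x v : M x -> tangent M x v -> quadric_field v x = v.
Proof.
by move=> Mx /(tangent_quadric _ GT Mx) xv; rewrite /quadric_field xv mulr0 scale0r subr0.
Qed.

(** As [v] is orthogonal to [x], pairing it with [y] or with the tangential projection of [y] gives
    the same number, so nondegeneracy passes from [G] to the tangent space. *)
Lemma nondegenerate_quadric : Defs.nondegenerate M (qf G).
Proof.
move=> x v Mx /(tangent_quadric _ GT Mx) xv h; apply: G_nondeg => y.
have := h (quadric_field y x); rewrite {2}/quadric_field !qfE (qfC v x GT) xv mulr0 subr0.
by apply; have [_] := vector_field_quadric_field y (@openT 'rV[R]_n); apply.
Qed.

Lemma pseudo_riemannian_quadric : pseudo_riemannian n.-1 M (qf G).
Proof. by split; [exact: submanifold_quadric|exact: nondegenerate_quadric]. Qed.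

Lemma is_levi_civita_quadric : is_levi_civita M (qf G) quadric_connection.
Proof.
split.
- move=> U Y x v YU Ux Mx tv; apply/(tangent_quadric _ GT Mx).
  rewrite /quadric_connection qfDr qfZr (quadric_d_field YU)//.
  by rewrite (quadric_self Mx) mulrAC mulVf// mul1r addNr.
- move=> U Y Y' x v YU YU' Ux Mx tv YY'.
  have [[sY _] [sY' _]] := (YU, YU'); have oU : open U by case: sY.
  have d : 'd Y x v = 'd Y' x v.
    have [dY dY'] := (smooth_differentiable sY Ux, smooth_differentiable sY' Ux).
    apply: tangent_diff_eq tv dY dY' _.
    by near=> y => My; apply: YY' => //; near: y; exact: open_nbhs_nbhs.
  exact: (congr2 (fun a b => a + (K^-1 * qf G v b) *: x) d (YY' x Ux Mx)).
- move=> U X Y [sX _] [sY _] x [Mx Ux]; have oU : open U by case: sX.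
  exists U, (fun y => quadric_connection y (X y) Y); split=> //.
  apply: smoothD.
    exact: (smooth_d_along (fun _ h => h) (smooth_id oU) sY sX).
  apply: smoothZ; last exact: smooth_id.
  by apply: smoothM; [exact: smooth_cst|exact: smooth_qf].
- move=> U Y x v w a _ _ _ _ _; rewrite /quadric_connection linearP !qfE.
  by rewrite mulrDr mulrCA scalerDl -(scalerA a) scalerDr; exact: addrACA.
- move=> U Y Z x v [sY _] [sZ _] Ux _ _; rewrite /quadric_connection.
  have E := diff_addE v (smooth_differentiable sY Ux) (smooth_differentiable sZ Ux).
  apply: (etrans (congr1 (fun a => a + (K^-1 * qf G v (Y x + Z x)) *: x) E)).
  by rewrite qfDr mulrDr scalerDl addrACA.
- move=> U f Y x v sf [sY _] Ux _ _; rewrite /quadric_connection.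
  have E := diff_scalemx v (smooth_differentiable sf Ux) (smooth_differentiable sY Ux).
  apply: (etrans (congr1 (fun a => a + (K^-1 * qf G v (f x *: Y x)) *: x) E)).
  by rewrite qfZr mulrCA -(scalerA (f x)) scalerDr addrA.
- move=> U X Y x XU YU Ux Mx; rewrite /quadric_connection /lie_bracket.
  by rewrite (qfC (X x) _ GT) opprD addrACA subrr addr0.
- move=> U Y Z x v YU ZU Ux Mx tv.
  have [[sY _] [sZ _]] := (YU, ZU).
  have [_ E] := diff_qf G v (smooth_differentiable sY Ux) (smooth_differentiable sZ Ux).
  apply: (etrans E); rewrite /quadric_connection !qfE.
  by rewrite (qfC _ x GT) !(quadric_field_orth _ Ux Mx)// !mulr0 !addr0.
Unshelve. all: by end_near. Qed.

(** For the difference [D] of the two connections, freedom from torsion makes [D X Z] symmetric, and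
    compatibility with the metric makes [qf G (D X Z) (W x)] skew in [Z] and [W]. Such an expression
    vanishes. *)
Lemma levi_civita_quadric_unique nabla nabla' : is_levi_civita M (qf G) nabla ->
  is_levi_civita M (qf G) nabla' -> forall U Y x v, vector_field M U Y -> U x ->
  M x -> tangent M x v -> nabla x v Y = nabla' x v Y.
Proof.
move=> L L' U Y x v YU Ux Mx tv; have oU : open U by case: YU => -[].
pose D X Z := nabla x (X x) Z - nabla' x (X x) Z.
have tX X : vector_field M U X -> tangent M x (X x) by move=> [_]; exact.
have Dsym X Z : vector_field M U X -> vector_field M U Z -> D X Z = D Z X.
  move=> XU ZU; apply/eqP; rewrite -subr_eq0 /D opprD addrACA -opprD.
  by rewrite (lc_torsion_free L XU ZU)// (lc_torsion_free L' XU ZU)// subrr.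
have Dskew X Z W : vector_field M U X -> vector_field M U Z -> vector_field M U W ->
    qf G (D X Z) (W x) = - qf G (D X W) (Z x).
  move=> XU ZU WU; apply/eqP; rewrite -addr_eq0 /D !qfE.
  have := lc_metric L ZU WU Ux Mx (tX _ XU).
  rewrite (lc_metric L' ZU WU Ux Mx (tX _ XU)).
  rewrite (qfC (Z x) _ GT) (qfC (Z x) _ GT) => /eqP; rewrite -subr_eq0 => /eqP e.
  by rewrite addrACA -opprD -opprB e oppr0.
suff : D (quadric_field v) Y = 0.
  by rewrite /D quadric_fieldE// => /eqP; rewrite subr_eq0 => /eqP.
have fU w := vector_field_quadric_field w oU.
apply: (nondegenerate_quadric Mx).
  apply/(tangent_quadric _ GT Mx); rewrite /D !qfE.
  have /(tangent_quadric _ GT Mx) -> := lc_tangent L YU Ux Mx (tX _ (fU v)).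
  have /(tangent_quadric _ GT Mx) -> := lc_tangent L' YU Ux Mx (tX _ (fU v)).
  by rewrite subrr.
move=> w tw; rewrite -(quadric_fieldE Mx tw).
move: (quadric_field v) (quadric_field w) (fU v) (fU w) => X Z XU ZU.
(* Three skew exchanges and three symmetric ones, in alternation, return to the same term with the
   opposite sign. *)
have e : qf G (D X Y) (Z x) = - qf G (D X Y) (Z x).
  rewrite {1}Dskew// Dsym// Dskew// opprK Dsym// Dskew// Dsym//.
by move/eqP: e; rewrite -addr_eq0 -mulr2n mulrn_eq0 => /eqP.
Qed.

(** The explicit connection shows that the choice in [levi_civita] is made from a nonempty set;
    uniqueness then identifies the chosen connection with it. *)
Lemma levi_civita_quadricE U Y x v : vector_field M U Y -> U x -> M x ->
  tangent M x v -> levi_civita M (qf G) x v Y = 'd Y x v + (K^-1 * qf G v (Y x)) *: x.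
Proof.
have L : is_levi_civita M (qf G) (levi_civita M (qf G)).
  by apply: (@xgetPex _ _ [set nabla | is_levi_civita M (qf G) nabla]);
    exists quadric_connection; exact: is_levi_civita_quadric.
exact: levi_civita_quadric_unique L is_levi_civita_quadric U Y x v.
Qed.

End LeviCivitaQuadric.

(** * Nondegenerate hypersurfaces of a quadric *)

Section SliceFrame.
Context {R : realType} {n d : nat} (N U V : set 'rV[R]_n).
Variables (Phi Psi : 'rV[R]_n -> 'rV[R]_n).
Hypothesis dPhi : diffeomorphism U V Phi Psi.
Hypothesis slice : forall y, U y ->
  (N y <-> forall i : 'I_n, (d <= i)%N -> Phi y 0 i = 0).

(** The field whose coordinates in the chart are the constant vector [e]. When only the first [d]
    entries of [e] are nonzero, it is tangent to [N]. *)
Definition slice_field (e y : 'rV[R]_n) : 'rV[R]_n := 'd Psi (Phi y) e.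

Lemma vector_field_slice_field (e : 'rV[R]_n) :
  (forall i : 'I_n, (d <= i)%N -> e 0 i = 0) -> vector_field N U (slice_field e).
Proof.
move=> e0; have [PhiU PsiV UV VU] := dPhi; split.
  apply: (@smooth_comp _ _ _ _ _ _ V Phi (fun w => 'd Psi w e)) => //.
    by move=> y /UV[].
  exact: smooth_d.
move=> y Uy Ny; apply/(slice_tangent _ dPhi Uy Ny slice) => i di.
have [Vy yK] := UV _ Uy.
have := diffeomorphism_dK e (diffeomorphism_sym dPhi) Vy.
by rewrite yK => ->; exact: e0.
Qed.

Lemma slice_field_d y v : U y -> slice_field ('d Phi y v) y = v.
Proof. by move=> Uy; exact: diffeomorphism_dK dPhi Uy. Qed.

Lemma d_slice_field y e : U y -> 'd Phi y (slice_field e y) = e.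
Proof.
move=> Uy; have [_ _ UV _] := dPhi; have [Vy yK] := UV _ Uy.
by have := diffeomorphism_dK e (diffeomorphism_sym dPhi) Vy; rewrite yK.
Qed.

Definition slice_frame (dn : (d <= n)%N) (y : 'rV[R]_n) : 'M[R]_(d, n) :=
  \matrix_i slice_field (delta_mx 0 (widen_ord dn i)) y.

Lemma slice_frame_mul dn y (a : 'rV[R]_d) : a *m slice_frame dn y =
  slice_field (\sum_i a 0 i *: delta_mx 0 (widen_ord dn i)) y.
Proof.
rewrite mulmx_sum_row /slice_field linear_sum; apply: eq_bigr => i _.
by rewrite linearZ rowK.
Qed.

Lemma slice_delta dn (i : 'I_d) (j : 'I_n) : (d <= j)%N ->
  (delta_mx 0 (widen_ord dn i) : 'rV[R]_n) 0 j = 0.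
Proof.
move=> dj; rewrite mxE; case: (j =P _) => [ji|]; last by rewrite andbF.
by move: dj; rewrite ji /= leqNgt ltn_ord.
Qed.

(** The coefficients are entries of ['d Phi y v], so they vary smoothly when [y] and [v] do. The
    fullness argument differentiates this expansion. *)
Lemma slice_coord (dn : (d <= n)%N) y v : U y -> N y -> tangent N y v ->
  v = \sum_i 'd Phi y v 0 (widen_ord dn i)
        *: slice_field (delta_mx 0 (widen_ord dn i)) y.
Proof.
move=> Uy Ny /(slice_tangent _ dPhi Uy Ny slice) e0.
rewrite -[LHS](slice_field_d v Uy) /slice_field.
under eq_bigr do rewrite -linearZ.
rewrite -linear_sum; congr ('d Psi _ _).
apply/rowP => j; rewrite summxE.
have [jd|dj] := ltnP j d; last first.
  by rewrite e0// big1// => i _; rewrite mxE slice_delta// mulr0.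
rewrite (bigD1 (Ordinal jd))//= big1 => [|i ij].
  rewrite (_ : widen_ord _ _ = j) ?mxE ?eqxx ?mulr1 ?addr0//; exact: val_inj.
rewrite mxE; case: (j =P widen_ord dn i) => [ji|/eqP ji].
  by move: ij; rewrite -val_eqE /= ji /= eqxx.
by rewrite mxE (negbTE ji) andbF mulr0.
Qed.

Lemma tangent_slice_frame dn y v : U y -> N y ->
  tangent N y v <-> (v <= slice_frame dn y)%MS.
Proof.
move=> Uy Ny; split=> [tv|/submxP[a ->]].
  apply/submxP; exists (\row_i 'd Phi y v 0 (widen_ord dn i)).
  apply: (etrans (slice_coord dn Uy Ny tv)); rewrite mulmx_sum_row.
  by apply: eq_bigr => i _; rewrite mxE rowK.
rewrite slice_frame_mul.
have [_] : vector_field N U (slice_field (\sum_i a 0 i *: delta_mx 0 (widen_ord dn i))).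
  apply: vector_field_slice_field => j dj.
  by rewrite summxE big1// => i _; rewrite mxE slice_delta// mulr0.
exact.
Qed.

Lemma slice_frame_free dn y : U y -> row_free (slice_frame dn y).
Proof.
move=> Uy; apply: inj_row_free => a; rewrite slice_frame_mul => a0.
have := d_slice_field (\sum_i a 0 i *: delta_mx 0 (widen_ord dn i)) Uy.
rewrite a0 linear0 => e; apply/rowP => i; rewrite mxE.
move/rowP: e => /(_ (widen_ord dn i)); rewrite mxE summxE.
rewrite (bigD1 i)//= big1 => [|j ji]; rewrite !mxE !eqxx /=.
  by rewrite mulr1 addr0.
case: eqP => [/(congr1 val) /= ij|]; rewrite ?mulr0//.
by move: ji; rewrite -val_eqE /= ij eqxx.
Qed.

End SliceFrame.

Lemma tangent_subset (R : realType) n (N M : set 'rV[R]_n) x v :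
  N `<=` M -> tangent N x v -> tangent M x v.
Proof.
by move=> NM [J [c [cJ J0 cN c0 cv]]]; exists J, c; split=> // t /cN/NM.
Qed.

Section QuadricHypersurface.
Context {R : realType} {n : nat} (G : 'M[R]_n) (K : R).
Hypothesis (GT : G^T = G) (K0 : K != 0).
Hypothesis G_nondeg : forall x, (forall y, qf G x y = 0) -> x = 0.
Let M := quadric G K.

(** [N] has dimension [n.-2], one less than [M]. The span [B] of its tangent space and of [p] is
    thus a hyperplane of the ambient space, and [xi] is a normal to it. *)
Lemma hypersurface_normal N p : (1 < n)%N -> N `<=` M ->
  submanifold n.-2 N -> Defs.nondegenerate N (qf G) -> N p ->
  exists xi, [/\ qf G xi p = 0, forall w, tangent N p w -> qf G xi w = 0 &
                 qf G xi xi != 0].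
Proof.
move=> n1 NM [dn chart] ndN Np.
have [U [V [Phi [Psi [dPhi Up slice]]]]] := chart _ Np.
have tN w := tangent_slice_frame dPhi slice dn w Up Np.
have W_free := slice_frame_free dPhi dn Up.
move: (slice_frame Phi Psi dn p) tN W_free => W tN W_free.
have Mp := NM _ Np; have pp := quadric_self Mp.
have pW w : tangent N p w -> qf G p w = 0.
  by move=> /(tangent_subset NM) /(tangent_quadric _ GT Mp).
pose B := col_mx W p.
have BE w : (w <= B)%MS -> exists2 w', tangent N p w' & exists t, w = w' + t *: p.
  move=> /submxP[a ->]; exists (lsubmx a *m W); first by apply/tN; exact: submxMl.
  exists (rsubmx a 0 0); rewrite -{1}[a]hsubmxK mul_row_col; congr (_ + _).
  by rewrite {1}[rsubmx a]mx11_scalar mul_scalar_mx.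
(* [p] is orthogonal to the tangent space of [N] and [qf G p p = K] is nonzero, so adjoining [p]
   raises the rank [n.-2] by one. *)
have rB : \rank B = n.-1.
  apply: (@etrans _ _ (n.-2 + 1)%N); last by rewrite addn1 prednK// -subn1 subn_gt0.
  apply/eqP/inj_row_free => a; rewrite -[a]hsubmxK mul_row_col.
  rewrite [rsubmx a]mx11_scalar mul_scalar_mx.
  set l := lsubmx a; set t := rsubmx a 0 0 => e.
  have lW : tangent N p (l *m W) by apply/tN; exact: submxMl.
  have t0 : t = 0.
    have := congr1 (qf G p) e; rewrite qfDr qfZr pW// pp qf0r add0r => /eqP.
    by rewrite mulf_eq0 (negbTE K0) orbF => /eqP.
  move: e; rewrite t0 scale0r addr0 => e.
  rewrite (row_free_inj W_free (etrans e (esym (mul0mx _ W)))).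
  by rewrite [_%:M](_ : _ = 0) ?row_mx0//; apply/matrixP => i j; rewrite !mxE mul0rn.
have kB : kermx (B *m G)^T != 0.
  rewrite kermx_eq0 /row_free mxrank_tr neq_ltn; apply/orP; left.
  apply: leq_ltn_trans (mxrankM_maxl _ _) _; rewrite rB.
  by rewrite prednK// ltnW.
have /rowV0Pn[xi /sub_kermxP xiB xi0] := kB.
have xi_orth w : (w <= B)%MS -> qf G xi w = 0.
  move=> /submxP[a ->]; rewrite /qf !trmx_mul mulmxA.
  by move: xiB; rewrite trmx_mul GT mulmxA => ->; rewrite mul0mx mxE.
have pB : (p <= B)%MS by rewrite -addsmxE addsmxSr.
have WB w : tangent N p w -> (w <= B)%MS.
  by move=> /tN wW; apply: submx_trans wW _; rewrite -addsmxE addsmxSl.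
exists xi; split; [exact: xi_orth|by move=> w /WB/xi_orth|].
(* A null [xi] would lie in its own orthogonal, a hyperplane that contains [B] and hence equals its
   row space by dimension. Then [xi] is a tangent vector plus a multiple of [p]; the multiple is
   zero since [xi] is orthogonal to [p], and nondegeneracy of [N] forces [xi = 0]. *)
apply/eqP => xixi; move/eqP: (xi0); apply.
have kxi w : (w <= kermx (G *m xi^T))%MS = (qf G xi w == 0).
  rewrite (qfC xi w GT) /qf -mulmxA; apply/sub_kermxP/eqP => [->|h].
    by rewrite mxE.
  by rewrite [LHS]mx11_scalar h; apply/matrixP => i j; rewrite !mxE mul0rn.
have Bk : (B <= kermx (G *m xi^T))%MS.
  by apply/row_subP => i; rewrite kxi xi_orth// row_sub.
have xiB' : (xi <= B)%MS.
  have kr : (\rank (kermx (G *m xi^T)) <= n.-1)%N.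
    rewrite mxrank_ker -subn1 leq_sub2l// lt0n mxrank_eq0.
    apply/eqP => Gxi; move/eqP: (xi0); apply; apply: G_nondeg => y.
    by rewrite (qfC xi y GT) /qf -mulmxA Gxi mulmx0 mxE.
  have : (kermx (G *m xi^T) <= B)%MS.
    by rewrite -(geq_leqif (mxrank_leqif_sup Bk)) rB.
  by apply: submx_trans; rewrite kxi xixi.
have [w tw [t xiE]] := BE _ xiB'.
have t0 : t = 0.
  have := xi_orth _ pB; rewrite (qfC xi p GT) xiE qfDr qfZr pW// pp add0r => /eqP.
  by rewrite mulf_eq0 (negbTE K0) orbF => /eqP.
move: xiE; rewrite t0 scale0r addr0 => xiE.
apply: (ndN p) => //; first by rewrite xiE.
by move=> w' /WB/xi_orth.
Qed.

(** The Levi-Civita derivative differs from the flat one by a multiple of [p], and [xi] annihilates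
    [p]. So the tangency required by total geodesy can be read on the flat derivative. *)
Lemma totally_geodesic_normal N U X Y p xi :
  nondegenerate_totally_geodesic_hypersurface n.-1 M (qf G) N ->
  vector_field N U X -> vector_field N U Y -> U p -> N p ->
  qf G xi p = 0 -> (forall w, tangent N p w -> qf G xi w = 0) ->
  qf G xi ('d Y p (X p)) = 0.
Proof.
move=> [NM _ tg] XU YU Up Np xip xiT.
have [[sY tY] [_ tX]] := (YU, XU); have oU : open U by case: sY.
have tNM y w : N y -> tangent N y w -> qf G y w = 0.
  move=> Ny /(tangent_subset NM) ty; exact/(tangent_quadric _ GT (NM _ Ny)).
(* [Y] is tangent to [N] along [N] but need not be tangent to [M] elsewhere, as [derivative_along]
   demands of the extension. [Yb] is its tangential projection, unchanged on [N]. *)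
pose Yb y := Y y - (K^-1 * qf G y (Y y)) *: y.
have sYb : smooth_on U Yb.
  apply: smoothD => //; apply: smooth_mxN; apply: smoothZ; last exact: smooth_id.
  by apply: smoothM; [exact: smooth_cst|apply: smooth_qf => //; exact: smooth_id].
have YbU : vector_field M U Yb.
  split=> // y Uy My; apply/(tangent_quadric _ GT My).
  by rewrite /Yb !qfE (quadric_self My) mulrAC mulVf// mul1r subrr.
have YbE y : U y -> N y -> Yb y = Y y.
  by move=> Uy Ny; rewrite /Yb (tNM y)// ?mulr0 ?scale0r ?subr0//; exact: tY.
have tXM : tangent M p (X p) by apply: tangent_subset NM _; exact: tX.
have dXp := diff_idE p (X p).
have tdXp : tangent M p ('d id p (X p)) by apply: eq_ind_r tXM _ dXp.
have /xiT : tangent N p (levi_civita M (qf G) p ('d id p (X p)) Yb).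
  apply: (tg U X Y p) => //; exists U, Yb; split=> //.
  near=> y => Ny; apply: etrans (esym (diff_idE y (Y y))).
  by apply: YbE => //; near: y; exact: open_nbhs_nbhs.
have -> := levi_civita_quadricE GT K0 G_nondeg YbU Up (NM _ Np) tdXp.
rewrite qfDr qfZr xip mulr0 addr0 => <-.
apply: (congr1 (qf G xi)); apply: esym.
apply: (etrans (congr1 ('d Yb p) dXp)).
apply: tangent_diff_eq (tX _ Up Np) _ _ _; try exact: smooth_differentiable Up.
by near=> y => Ny; apply: YbE => //; near: y; exact: open_nbhs_nbhs.
Unshelve. all: by end_near. Qed.

End QuadricHypersurface.

(** * Affine isometric immersions between quadrics *)

Section AffineImmersion.
Context {R : realType} {k n : nat} (S : 'M[R]_k) (G : 'M[R]_n).
Variables (L : 'M[R]_(k, n)) (c0 : 'rV[R]_n) (K : R).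
Hypotheses (ST : S^T = S) (GT : G^T = G).
Hypothesis G_nondeg : forall x, (forall y, qf G x y = 0) -> x = 0.
Hypothesis L_inj : forall x : 'rV_k, x *m L = 0 -> x = 0.
Hypothesis L_isom : forall x y, qf G (x *m L) (y *m L) = qf S x y.
Hypothesis c0_orth : forall x, qf G c0 (x *m L) = 0.
Hypothesis c0_norm : qf G c0 c0 = - 1 - K.
Let phi (z : 'rV[R]_k) : 'rV[R]_n := z *m L + c0.
Let M := quadric S K.
Let Mbar := quadric G (-1).

Let N1_neq0 : (-1 : R) != 0. Proof. by rewrite oppr_eq0 oner_eq0. Qed.

Lemma qf_affine z x : qf G (phi z) (x *m L) = qf S z x.
Proof. by rewrite /phi qfDl L_isom c0_orth addr0. Qed.

Lemma affine_quadric z : M z -> Mbar (phi z).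
Proof.
move=> [zS zK].
have q : qf G (phi z) (phi z) = -1.
  rewrite {2}/phi qfDr qf_affine zK /phi qfDl (qfC _ c0 GT) c0_orth c0_norm; ring.
split=> //; apply/eqP => phiG.
by move/eqP: q; rewrite /qf phiG mul0mx mxE eq_sym (negbTE N1_neq0).
Qed.

Lemma smooth_affine : smooth_on setT phi.
Proof.
have oT := @openT 'rV[R]_k.
apply: smoothD; last exact: smooth_cst.
by apply: smooth_mulmx; [exact: smooth_id|exact: smooth_cst].
Qed.

Lemma diff_mulmxr (f : 'rV[R]_k -> 'rV[R]_k) z v : differentiable f z ->
  differentiable (fun y => f y *m L) z /\
  'd (fun y => f y *m L) z v = 'd f z v *m L.
Proof.
move=> df; have dL : differentiable (fun _ : 'rV[R]_k => L) z.
  exact: differentiable_cst.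
have [d E] := diff_mulmx v df dL; split=> //; apply: (etrans E).
apply: (etrans (congr1 (fun A => _ + f z *m A) (diff_cstE L z v))).
by rewrite mulmx0 addr0.
Qed.

Lemma diff_affine z v : 'd phi z v = v *m L.
Proof.
have di := @ex_diff _ _ _ _ _ _ _ (is_diff_id z).
have [d E] := diff_mulmxr v di.
have dc : differentiable (fun _ : 'rV[R]_k => c0) z by exact: differentiable_cst.
apply: (etrans (diff_addE v d dc)).
apply: (etrans (congr1 (fun a => _ + a) (diff_cstE c0 z v))).
rewrite addr0; apply: (etrans E).
exact: (congr1 (fun a => a *m L) (diff_idE z v)).
Qed.

Lemma pullback_affine z v w : pullback phi (qf G) z v w = qf S v w.
Proof.
by rewrite -L_isom; exact: (congr2 (qf G) (diff_affine z v) (diff_affine z w)).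
Qed.

Lemma isometric_affine : isometric M (qf S) phi (qf G).
Proof. by move=> z v w _ _ _; exact: pullback_affine. Qed.

Lemma immersion_affine : immersion M phi Mbar.
Proof.
split; [exists setT => //; exact: smooth_affine|exact: affine_quadric|].
move=> z v _ _ dv0; apply: L_inj; exact: (etrans (esym (diff_affine z v))).
Qed.

(** * The radical of the induced metric *)

Lemma qf_eq0 x : (forall y, qf S x y = 0) -> x *m S = 0.
Proof.
move=> h; apply/rowP => i; rewrite [RHS]mxE -(h (delta_mx 0 i)).
by rewrite /qf trmx_delta -colE [RHS]mxE.
Qed.

(** The tangent space is the kernel of [qf S z]. A form [qf S v] that vanishes on it is a multiple
    of [qf S z], with the factor [a] given by its value at [conormal S z]. *)
Lemma radical_affine z v : M z -> (radical M phi (qf G) z v <->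
  qf S z v = 0 /\ exists a, (v - a *: z) *m S = 0).
Proof.
move=> zM; have [zS zK] := zM; split=> [[/(tangent_quadric _ ST zM) zv h]|].
  split=> //; exists (qf S v (conormal S z)); apply: qf_eq0 => y.
  have := h (y - qf S z y *: conormal S z).
  rewrite pullback_affine; have nu1 := qf_conormal zS.
  move: (conormal S z) nu1 => nu nu1.
  rewrite !qfE mulrC => ->//.
  by apply/(tangent_quadric _ ST zM); rewrite !qfE nu1 mulr1 subrr.
move=> [zv [a vS]]; split; first exact/(tangent_quadric _ ST zM).
move=> w /(tangent_quadric _ ST zM) zw; rewrite pullback_affine.
have : qf S (v - a *: z) w = 0 by rewrite /qf vS mul0mx mxE.
by rewrite !qfE zw mulr0 subr0.
Qed.

(** Pairing [v - a *: z] with [z] gives [a * K = 0], so for [K != 0] the radical is exactly the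
    kernel of [S]. *)
Lemma lightlike_affine r (A : 'M[R]_(r, k)) : K != 0 -> (0 < r)%N ->
  row_free A -> (forall v : 'rV_k, v *m S = 0 <-> (v <= A)%MS) ->
  lightlike r M phi (qf G).
Proof.
move=> K0 r0 Afree AE; split=> // z zM; exists A; split=> // v.
rewrite radical_affine// -AE; split=> [[zv [a vS]]|vS].
  suff a0 : a = 0 by move: vS; rewrite a0 scale0r subr0.
  have : qf S (v - a *: z) z = 0 by rewrite /qf vS mul0mx mxE.
  have [_ zK] := zM; rewrite !qfE (qfC v z ST) zv zK add0r => /eqP.
  by rewrite oppr_eq0 mulf_eq0 (negbTE K0) orbF => /eqP.
split; first by rewrite (qfC z v ST) /qf vS mul0mx mxE.
by exists 0; rewrite scale0r subr0.
Qed.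

(** On a null cone [z] is tangent and itself radical. It is outside the kernel of [S], whence one
    more dimension. *)
Lemma lightlike_affine0 r (A : 'M[R]_(r, k)) : K = 0 ->
  row_free A -> (forall v : 'rV_k, v *m S = 0 <-> (v <= A)%MS) ->
  lightlike (1 + r) M phi (qf G).
Proof.
move=> K0 Afree AE; split=> // z zM; exists (col_mx z A).
have [zS zK] := zM.
have AS (b : 'rV_r) : b *m A *m S = 0 by apply/AE; exact: submxMl.
split.
  apply: inj_row_free => b; rewrite -[b]hsubmxK mul_row_col => e.
  have l0 : lsubmx b = 0.
    have := congr1 (fun u => u *m S) e.
    rewrite mulmxDl AS addr0 mul0mx {1}[lsubmx b]mx11_scalar mul_scalar_mx => /eqP.
    rewrite -scalemxAl scaler_eq0 (negbTE zS) orbF => /eqP b0.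
    by rewrite [LHS]mx11_scalar b0; apply/rowP => i; rewrite !mxE mul0rn.
  move: e; rewrite l0 mul0mx add0r => e.
  by rewrite (row_free_inj Afree (etrans e (esym (mul0mx _ A)))) row_mx0.
move=> v; rewrite radical_affine//; split=> [[zv [a /AE vA]]|].
  rewrite -[v](subrK (a *: z)); apply: addmx_sub.
    by apply: submx_trans vA _; rewrite -addsmxE addsmxSr.
  by apply: scalemx_sub; rewrite -addsmxE addsmxSl.
move=> /submxP[b ->]; rewrite -[b]hsubmxK mul_row_col.
rewrite [lsubmx b]mx11_scalar mul_scalar_mx; set a := lsubmx b 0 0.
split; last by exists a; rewrite addrAC subrr add0r AS.
by rewrite qfDr qfZr zK K0 mulr0 add0r (qfC _ _ ST) /qf AS mul0mx mxE.
Qed.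

(** * Transversal bundle and second fundamental form *)

Let c : nat := \rank (L^C)%MS.
(** A linear complement of the image of [L], with no orthogonality imposed: for degenerate [S] the
    image of [L] meets its own orthogonal. Since [L] is injective, [c = n - k], which is also the
    codimension of [M] in [Mbar]. *)
Let C : 'M[R]_(c, n) := row_base (L^C)%MS.

Let LC_split (w : 'rV[R]_n) : exists (a : 'rV[R]_k) (b : 'rV[R]_c), w = a *m L + b *m C.
Proof.
have : (w <= L + C)%MS.
  rewrite (adds_eqmx (eqmx_refl L) (eq_row_base _)).
  exact: submx_full (addsmx_compl_full L).
by move=> /sub_addsmxP[[a b] /= ->]; exists a, b.
Qed.

Let LC_direct (a : 'rV[R]_k) (b : 'rV[R]_c) : a *m L + b *m C = 0 -> a = 0 /\ b = 0.
Proof.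
move=> e; have aL : a *m L = 0.
  apply/eqP; rewrite -submx0 -(capmx_compl L) sub_capmx submxMl /=.
  move/eqP: e; rewrite addr_eq0 => /eqP ->; rewrite -mulNmx.
  by apply: submx_trans (submxMl _ _) _; rewrite eq_row_base.
split; first exact: L_inj.
move: e; rewrite aL add0r => e.
exact: (row_free_inj (row_base_free _) (etrans e (esym (mul0mx _ C)))).
Qed.

(* The rows of [C], corrected by multiples of the image of the conormal so as
   to become tangent to the ambient quadric. *)
Let frame (z : 'rV[R]_k) : 'M[R]_(c, n) :=
  C - (C *m G *m (phi z)^T) *m (conormal S z *m L).

Let frameE z (b : 'rV[R]_c) :
  b *m frame z = b *m C - qf G (b *m C) (phi z) *: (conormal S z *m L).
Proof.
rewrite /frame mulmxBr; congr (_ - _); rewrite !mulmxA [_ *m (phi z)^T]mx11_scalar.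
by rewrite -mulmxA mul_scalar_mx.
Qed.

Let tr (z : 'rV[R]_k) : set 'rV[R]_n := [set w | (w <= frame z)%MS].

Let smooth_frame : smooth_on [set z | z *m S != 0] frame.
Proof.
have sn := smooth_conormal S; have [oU _] := sn.
have sC (m p : nat) (A : 'M[R]_(m, p)) := smooth_cst A oU.
have sphi := smooth_subset oU (fun _ _ => I) smooth_affine.
apply: smoothD => //; apply: smooth_mxN; apply: smooth_mulmx.
  by apply: smooth_mulmx => //; exact: smooth_tr.
exact: smooth_mulmx.
Qed.

(** The rows of [frame z] differ from those of [C] by elements of the image of [L], and the sum of
    the two row spaces is direct. *)
Let frame_free z : row_free (frame z).
Proof.
apply: inj_row_free => b; rewrite frameE addrC scalemxAl -mulNmx => e.
by have [] := LC_direct e.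
Qed.

Lemma transversal_affine : transversal_bundle M phi Mbar tr.
Proof.
split.
- exists c => z [zS _]; exists [set z | z *m S != 0], frame; split=> //.
- move=> z _ zM /submxP[b ->]; have [zS _] := zM.
  apply/(tangent_quadric _ GT (affine_quadric zM)).
  rewrite frameE qfDr qfNr qfZr qf_affine qf_conormal// mulr1.
  by rewrite (qfC _ _ GT) subrr.
- move=> z w zM; have [zS _] := zM.
  move=> /(tangent_quadric _ GT (affine_quadric zM)) zw.
  have [a [b wE]] := LC_split w.
  (* The multiple of the conormal subtracted in [frame] is given back to the component in the image
     of [L]. *)
  pose v := a + qf G (b *m C) (phi z) *: conormal S z.
  have wE' : w = v *m L + b *m frame z.
    by rewrite frameE /v mulmxDl -scalemxAl addrACA subrr addr0.
  have bT : qf G (phi z) (b *m frame z) = 0.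
    rewrite frameE qfDr qfNr qfZr qf_affine qf_conormal// mulr1.
    by rewrite (qfC _ _ GT) subrr.
  exists v, (b *m frame z); split.
  + apply/(tangent_quadric _ ST zM).
    by move: zw; rewrite wE' qfDr bT addr0 qf_affine.
  + exact: submxMl.
  + by rewrite wE'; congr (_ + _); apply: esym; exact: diff_affine.
- move=> z v zM tv /=; have -> := diff_affine z v.
  move=> /submxP[b]; rewrite frameE => e.
  have : (v + qf G (b *m C) (phi z) *: conormal S z) *m L + (- b) *m C = 0.
    by rewrite mulmxDl -scalemxAl e subrK mulNmx subrr.
  move=> /LC_direct[_ /eqP]; rewrite oppr_eq0 => /eqP b0.
  by rewrite e b0 mul0mx qf0l scale0r subrr.
Qed.

(** The derivative of dphi(Y) is ['d Y z (X z) *m L - g *: phi z], where [g] is the induced metric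
    on [X z] and [Y z]. Its component along [C] comes only from the part [b0 *m C] of [c0], which
    gives the factor [- g]. *)
Lemma second_fundamental_form_affine (a0 : 'rV[R]_k) (b0 : 'rV[R]_c) U X Y z b :
  c0 = a0 *m L + b0 *m C ->
  vector_field M U X -> vector_field M U Y -> U z -> M z ->
  second_fundamental_form M phi Mbar (levi_civita Mbar (qf G)) tr X Y z b ->
  b = pullback phi (qf G) z (X z) (Y z) *: - (b0 *m frame z).
Proof.
move=> c0E XU YU Uz zM [/= /submxP[be ->] [v tv [V [Yb [YbV Vz YbY w]]]]].
have oU : open U by case: XU => -[].
have tX : tangent M z (X z) by case: XU => _; exact.
have zMb := affine_quadric zM.
have dphi : differentiable phi z by exact: smooth_differentiable smooth_affine I.
have dY : differentiable Y z by case: YU => sY _; exact: smooth_differentiable sY Uz.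
have tLX : tangent Mbar (phi z) ('d phi z (X z)).
  exact: tangent_map smooth_affine _ affine_quadric tX.
have YbE : Yb (phi z) = Y z *m L.
  rewrite (nbhs_singleton YbY)//; exact: diff_affine.
have dYb : differentiable Yb (phi z).
  by case: YbV => sY _; exact: smooth_differentiable sY Vz.
have D : 'd Yb (phi z) ('d phi z (X z)) = 'd Y z (X z) *m L.
  have /(congr1 (fun h : 'rV[R]_k -> 'rV[R]_n => h (X z))) E := diff_comp dphi dYb.
  apply: (etrans (esym E)).
  have [d E'] := diff_mulmxr (X z) dY; apply: etrans E'.
  apply: tangent_diff_eq tX _ d _; first exact: differentiable_comp.
  near=> y => My; apply: (etrans _ (diff_affine y (Y y))).
  by apply: (near YbY y).
rewrite pullback_affine.
have e1 := etrans w (levi_civita_quadricE GT N1_neq0 G_nondeg YbV Vz zMb tLX).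
have e2 := etrans e1 (congr2 (fun a q => a + ((-1)^-1 * q) *: phi z) D
  (congr2 (qf G) (diff_affine z (X z)) YbE)).
have := etrans (congr1 (fun a => a + be *m frame z) (esym (diff_affine z v))) e2.
move: ('d Y z (X z)) => DY; rewrite L_isom invrN1 mulN1r.
move: (qf S (X z) (Y z)) => g e.
suff -> : be = - (g *: b0) by rewrite mulNmx -scalemxAl scalerN.
move: e; rewrite frameE; move: (qf G _ _) (conormal S z) => x nu e.
(* All terms are gathered into one vanishing sum of a row of the image of [L] and a row of the span
   of [C]; only the coefficient of [C] is wanted. *)
have : (v - x *: nu - DY + g *: z + g *: a0) *m L + (be + g *: b0) *m C = 0.
  rewrite !mulmxDl !mulNmx -!scalemxAl.
  have -> : g *: (z *m L) = g *: phi z - g *: (a0 *m L) - g *: (b0 *m C).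
    by rewrite /phi c0E; apply/rowP => i; rewrite !mxE; ring.
  have -> : DY *m L = v *m L + (be *m C - x *: (nu *m L)) + g *: phi z.
    by rewrite e scaleNr subrK.
  apply/rowP => i; rewrite !mxE; ring.
move=> /LC_direct[_ /eqP]; rewrite addr_eq0 => /eqP.
Unshelve. all: by end_near. Qed.

Lemma totally_umbilical_affine : totally_umbilical M phi Mbar (qf G).
Proof.
have [a0 [b0 c0E]] := LC_split c0.
exists tr, (fun z => - (b0 *m frame z)); split.
- exact: transversal_affine.
- move=> z [zS _]; exists [set z | z *m S != 0], (fun z => - (b0 *m frame z)).
  split=> //; apply: smooth_mxN; apply: smooth_mulmx => //.
  by apply: smooth_cst; case: smooth_frame.
- by move=> z _; rewrite /tr /= -mulNmx submxMl.
- by move=> U X Y z b; exact: second_fundamental_form_affine c0E.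
Qed.

Lemma totally_geodesic_linear : c0 = 0 -> totally_geodesic M phi Mbar (qf G).
Proof.
move=> c00; exists tr; first exact: transversal_affine.
move=> U X Y z b XU YU Uz zM bE.
have c0E : c0 = 0 *m L + 0 *m C by rewrite !mul0mx addr0.
rewrite (second_fundamental_form_affine c0E XU YU Uz zM bE).
by rewrite mul0mx oppr0 scaler0.
Qed.

(** * Fullness *)

Hypothesis LC_isotropic : forall xi, (forall x, qf G xi (x *m L) = 0) ->
  qf G xi c0 = 0 -> qf G xi xi = 0.

(** The second derivative is taken at [z] in the direction [v]. For [K != 0] a direction with
    [qf S v v != 0] forces [l = 0]; for [K = 0] the product [l * K] vanishes by itself. *)
Lemma full_affine z v : (1 < n)%N -> M z -> qf S z v = 0 ->
  K * qf S v v != 0 \/ K = 0 -> full n.-1 M phi Mbar (qf G).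
Proof.
move=> n1 zM zv Kv [N NMtg phiN]; have [NM [sN ndN] _] := NMtg.
have MN y : M y -> N (phi y) by move=> My; apply: phiN; exists y.
have Np := MN _ zM; have [zS zK] := zM.
have [xi [xip xiT xi_nz]] :=
  hypersurface_normal GT N1_neq0 G_nondeg n1 NM sN ndN Np.
have [dn chart] := sN; have [U [V [Phi [Psi [dPhi Up slice]]]]] := chart _ Np.
pose O : set 'rV[R]_k := [set y | y *m S != 0] `&` (phi @^-1` U).
have phiC : continuous phi.
  move=> y; apply: differentiable_continuous.
  exact: smooth_differentiable smooth_affine _.
have sPhi : smooth_on U Phi by case: dPhi.
have [oU _] := sPhi.
have [oS snu] := smooth_conormal S.
have oO : open O by apply: openI => //; apply: open_comp => // y _; exact: phiC.
have zO : O z by split.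
(* A local field of [M] through [v]. The correction uses the conormal since, for [K = 0],
   subtracting a multiple of [y] would not change the pairing with [y]. *)
pose X y := v - qf S y v *: conormal S y.
have Xz : X z = v by rewrite /X zv scale0r subr0.
have sX : smooth_on O X.
  apply: smoothD; first exact: smooth_cst.
  apply: smooth_mxN; apply: smoothZ.
    by apply: smooth_qf; [exact: smooth_id|exact: smooth_cst].
  by apply: smooth_subset (smooth_conormal S) => // y [].
have XO : vector_field M O X.
  split=> // y _ My; apply/(tangent_quadric _ ST My).
  have [yS _] := My; have nu1 := qf_conormal yS; rewrite /X.
  by move: (conormal S y) nu1 => nu nu1; rewrite !qfE nu1 mulr1 subrr.
have tangentL y w : M y -> qf S y w = 0 -> tangent N (phi y) (w *m L).
  move=> My /(tangent_quadric _ ST My) tw.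
  rewrite -(diff_affine y w).
  exact: tangent_map smooth_affine (fun _ _ => I) MN tw.
(* Differentiating the expansion [aY] along [v] expresses the second derivative
   of [phi] through derivatives of fields of [N], which [xi] annihilates. *)
pose e (i : 'I_n.-2) : 'rV[R]_n := delta_mx 0 (widen_ord dn i).
pose a i y := 'd Phi (phi y) (X y *m L) 0 (widen_ord dn i).
pose Y i := slice_field Phi Psi (e i).
have aY y : O y -> M y -> \sum_i a i y *: Y i (phi y) = X y *m L.
  move=> Oy My; have [_ Uy] := Oy; have [_ tX] := XO.
  have /(tangent_quadric _ ST My) Xy := tX y Oy My.
  exact: esym (slice_coord dPhi slice dn Uy (MN _ My) (tangentL _ _ My Xy)).
have YU i : vector_field N U (Y i).
  by apply: (vector_field_slice_field dPhi slice) => j dj; exact: slice_delta.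
have sphiO : smooth_on O phi by exact: smooth_subset smooth_affine.
have sa i : smooth_on O (a i).
  apply: (@smooth_entry _ _ _ _ _ (fun y => 'd Phi (phi y) (X y *m L))).
  apply: (smooth_d_along (U' := U) _ sphiO sPhi); first by move=> y [].
  by apply: smooth_mulmx => //; exact: smooth_cst.
have sYphi i : smooth_on O (Y i \o phi).
  by apply: smooth_comp sphiO (proj1 (YU i)) => y [].
have dX : differentiable X z by exact: smooth_differentiable sX zO.
have tv : tangent M z v by exact/(tangent_quadric _ ST zM).
have DE : 'd (fun y => \sum_i a i y *: Y i (phi y)) z v = 'd X z v *m L.
  have [d E] := diff_mulmxr v dX; apply: etrans E.
  apply: tangent_diff_eq tv _ d _.
    apply: differentiable_sumf => i.
    by apply: smooth_differentiable zO; apply: smoothZ; [exact: sa|exact: sYphi].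
  by near=> y => My; apply: aY => //; near: y; exact: open_nbhs_nbhs.
have xiY i : qf G xi (Y i (phi z)) = 0.
  by apply: xiT; case: (YU i) => _; apply.
have tvL := tangentL _ _ zM zv.
(* The direction [v *m L] is extended to the field of [N] with constant chart coordinates, so that
   total geodesy applies to two fields of [N]. *)
have xiDY i : qf G xi ('d (Y i) (phi z) (v *m L)) = 0.
  have XU : vector_field N U (slice_field Phi Psi ('d Phi (phi z) (v *m L))).
    apply: (vector_field_slice_field dPhi slice).
    exact/(slice_tangent _ dPhi Up Np slice).
  rewrite -(slice_field_d dPhi (v *m L) Up).
  exact: (totally_geodesic_normal GT N1_neq0 G_nondeg NMtg XU (YU i) Up Np xip xiT).
have xiDX : qf G xi ('d X z v *m L) = 0.
  rewrite -DE.
  have sY i : differentiable (Y i \o phi) z := smooth_differentiable (sYphi i) zO.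
  have saz i : differentiable (a i) z := smooth_differentiable (sa i) zO.
  have dY i : 'd (fun y => Y i (phi y)) z v = 'd (Y i) (phi z) (v *m L).
    have dphi := smooth_differentiable smooth_affine (I : setT z).
    have /(congr1 (fun h : 'rV[R]_k -> 'rV[R]_n => h v)) E :=
      diff_comp dphi (smooth_differentiable (proj1 (YU i)) Up).
    apply: (etrans E); exact: (congr1 ('d (Y i) (phi z)) (diff_affine z v)).
  have dt i : differentiable (fun y => a i y *: Y i (phi y)) z.
    by apply: smooth_differentiable zO; apply: smoothZ; [exact: sa|exact: sYphi].
  apply: (etrans (congr1 (qf G xi) (diff_sumf v dt))).
  rewrite qf_sumr big1// => i _.
  apply: (etrans (congr1 (qf G xi) (diff_scalemx v (saz i) (sY i)))).
  rewrite qfDr !qfZr; apply: (etrans (congr1 (fun w => _ + _ * qf G xi w) (dY i))).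
  by rewrite xiDY xiY !mulr0 addr0.
have [nu nu1] : exists nu, qf S z nu = 1.
  by exists (conormal S z); exact: qf_conormal.
(* Vectors in the kernel of [qf S z] are mapped by [L] to tangent vectors of [N], which [xi]
   annihilates. So [x |-> qf G xi (x *m L)] is a multiple of [qf S z], and [nu] reads off the
   factor. *)
pose l := qf G xi (nu *m L).
have xiL x : qf G xi (x *m L) = l * qf S z x.
  have : qf G xi ((x - qf S z x *: nu) *m L) = 0.
    by apply/xiT/tangentL => //; rewrite !qfE nu1 mulr1 subrr.
  rewrite mulmxBl -scalemxAl qfDr qfNr qfZr -/l => /eqP.
  by rewrite subr_eq0 mulrC => /eqP.
have lK : l * K = 0.
  case: Kv => [|->]; last by rewrite mulr0.
  rewrite mulf_eq0 negb_or => /andP[_ vv]; suff -> : l = 0 by rewrite mul0r.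
  (* Tangency of [X] differentiates to [qf S z ('d X z v) = - qf S v v], which turns [xiDX] into
     [l * qf S v v = 0]. *)
  move: xiDX; rewrite xiL (quadric_d_field ST XO zO zM tv) Xz => /eqP.
  by rewrite mulf_eq0 oppr_eq0 (negbTE vv) orbF => /eqP.
have xic0 : qf G xi c0 = 0.
  by move: xip; rewrite /phi qfDr xiL zK lK add0r.
move/eqP: xi_nz; apply.
have : qf G (xi - l *: (z *m L)) (xi - l *: (z *m L)) = 0.
  apply: LC_isotropic => [x|]; first by rewrite !qfE xiL L_isom subrr.
  by rewrite !qfE xic0 (qfC _ c0 GT) c0_orth mulr0 subr0.
rewrite !qfE xiL (qfC (z *m L) xi GT) xiL L_isom zK lK => h.
by rewrite -[RHS]h; ring: lK.
Unshelve. all: by end_near. Qed.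

Lemma full_umbilical_lightlike_affine r z v : (1 < n)%N -> M z -> qf S z v = 0 ->
  K * qf S v v != 0 \/ K = 0 -> lightlike r M phi (qf G) ->
  full_umbilical_lightlike k.-1 n.-1 r M (qf S) phi Mbar (qf G).
Proof.
move=> n1 zM zv Kv lM; split; split=> //.
- exact: submanifold_quadric.
- exact: pseudo_riemannian_quadric.
- exact: immersion_affine.
- exact: isometric_affine.
- exact: totally_umbilical_affine.
- exact: full_affine zM zv Kv.
Qed.

End AffineImmersion.

(** * Cylinders in pseudo-hyperbolic spaces *)

Section PseudoEuclidean.
Context {R : realType}.

Definition pmx n p : 'M[R]_n := diag_mx (\row_i (if (i < p)%N then -1 else 1)).

Lemma pformE n p : pform p = qf (pmx n p).
Proof.
apply/funext => x; apply/funext => y; rewrite /qf /pform mxE.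
apply: eq_bigr => i _; rewrite mul_mx_diag !mxE.
by case: ifP; rewrite ?mulrN1 ?mulNr ?mulr1.
Qed.

Lemma pmx_sym n p : (pmx n p)^T = pmx n p.
Proof. exact: tr_diag_mx. Qed.

Lemma pform_nondeg n p (x : 'rV[R]_n) : (forall y, pform p x y = 0) -> x = 0.
Proof.
move=> h; apply/rowP => i; have := h (delta_mx 0 i).
rewrite /pform (bigD1 i)//= big1 => [|j ji].
  rewrite !mxE !eqxx mulr1 addr0; case: ifP => // _ /eqP.
  by rewrite oppr_eq0 => /eqP.
by rewrite !mxE (negbTE ji) mulr0 oppr0 if_same.
Qed.

Lemma qf_pmx_nondeg n p (x : 'rV[R]_n) : (forall y, qf (pmx n p) x y = 0) -> x = 0.
Proof. by rewrite -pformE; exact: pform_nondeg. Qed.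

Lemma pmx_mul_eq0 n p (x : 'rV[R]_n) : (x *m pmx n p == 0) = (x == 0).
Proof.
apply/eqP/eqP => [h|->]; last by rewrite mul0mx.
by apply: (@qf_pmx_nondeg _ p) => y; rewrite /qf h mul0mx mxE.
Qed.

Lemma pform_row n1 n2 p (x x' : 'rV[R]_n1) (y y' : 'rV[R]_n2) :
  pform p (row_mx x y) (row_mx x' y') = pform p x x' + pform (p - n1) y y'.
Proof.
rewrite /pform big_split_ord; congr (_ + _); apply: eq_bigr => i _.
  by rewrite !row_mxEl.
by rewrite !row_mxEr /= ltn_subRL.
Qed.

Lemma pform1S p (a b : 'rV[R]_1) : pform p.+1 a b = - (a 0 0 * b 0 0).
Proof. by rewrite /pform big_ord1. Qed.

Lemma pform1_0 (a b : 'rV[R]_1) : pform 0 a b = a 0 0 * b 0 0.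
Proof. by rewrite /pform big_ord1. Qed.

Lemma pform0l n p (x : 'rV[R]_n) : pform p 0 x = 0.
Proof. by rewrite pformE qf0l. Qed.

Lemma pform0r n p (x : 'rV[R]_n) : pform p x 0 = 0.
Proof. by rewrite pformE qf0r. Qed.

Lemma pform_delta n p (i j : 'I_n) : pform p (delta_mx 0 i : 'rV[R]_n) (delta_mx 0 j) =
  if i == j then (if (i < p)%N then -1 else 1) else 0.
Proof.
rewrite /pform (bigD1 i)//= big1 => [|l li].
  rewrite !mxE !eqxx mul1r addr0; case: (eqVneq i j) => [->|ij] //=.
  by rewrite oppr0 if_same.
by rewrite !mxE (negbTE li) mul0r oppr0 if_same.
Qed.

Lemma pseudo_hyperbolicE n p : pseudo_hyperbolic p 1 = quadric (pmx n p.+1) (-1).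
Proof.
apply/seteqP; split=> x /=; rewrite /pseudo_hyperbolic /= pformE expr1n.
  move=> x1; split=> //; rewrite pmx_mul_eq0; apply/eqP => x0.
  by move/eqP: x1; rewrite x0 qf0l eq_sym oppr_eq0 oner_eq0.
by case.
Qed.

Lemma lightconeE n p : lightcone R n p = quadric (pmx n p.+1) 0.
Proof.
by apply/seteqP; split=> x /=; rewrite /quadric /= pmx_mul_eq0 -pformE.
Qed.

(** * Products of a quadric with the degenerate line *)

Definition cylinder_mx m q : 'M[R]_(m + 1) := block_mx (pmx m q) 0 0 0.

Lemma mul_cylinder_mx m q (z : 'rV[R]_(m + 1)) :
  z *m cylinder_mx m q = row_mx (lsubmx z *m pmx m q) 0.
Proof.
by rewrite -{1}[z]hsubmxK mul_row_block !mulmx0 !addr0.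
Qed.

Lemma mul_cylinder_mx_eq0 m q (z : 'rV[R]_(m + 1)) :
  (z *m cylinder_mx m q == 0) = (lsubmx z == 0).
Proof. by rewrite mul_cylinder_mx row_mx_eq0 eqxx andbT pmx_mul_eq0. Qed.

Lemma cylinder_mx_sym m q : (cylinder_mx m q)^T = cylinder_mx m q.
Proof. by rewrite /cylinder_mx tr_block_mx pmx_sym !trmx0. Qed.

Lemma qf_cylinder m q z w :
  qf (cylinder_mx m q) z w = pform q (lsubmx z) (lsubmx w).
Proof.
rewrite pformE /qf mul_cylinder_mx -{1}[w]hsubmxK tr_row_mx mul_row_col.
by rewrite mul0mx addr0.
Qed.

Lemma times_line_formE m q : times_line_form (pform q) = qf (cylinder_mx m q).
Proof.
by apply/funext => z; apply/funext => w; rewrite qf_cylinder.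
Qed.

Lemma times_lineE m q K (A : set 'rV[R]_m) :
  (forall x, A x <-> x != 0 /\ pform q x x = K) ->
  times_line A = quadric (cylinder_mx m q) K.
Proof.
move=> AE; apply/seteqP; split=> z; rewrite /times_line /quadric /=;
  by rewrite mul_cylinder_mx_eq0 qf_cylinder => /AE.
Qed.

Lemma cylinder_kernel m q (v : 'rV[R]_(m + 1)) :
  v *m cylinder_mx m q = 0 <-> (v <= (row_mx 0 1%:M : 'M[R]_(1, m + 1)))%MS.
Proof.
split=> [/eqP|/submxP[a ->]]; last first.
  by apply/eqP; rewrite mul_cylinder_mx_eq0 mul_mx_row row_mxKl mulmx0.
rewrite mul_cylinder_mx_eq0 => /eqP v0; apply/submxP; exists (rsubmx v).
by rewrite mul_mx_row mulmx0 mulmx1 -{1}[v]hsubmxK v0.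
Qed.

Lemma cylinder_kernel_free m : row_free (row_mx 0 1%:M : 'M[R]_(1, m + 1)).
Proof.
apply: inj_row_free => a; rewrite mul_mx_row mulmx1 => e.
by have := congr1 rsubmx e; rewrite row_mxKr linear0.
Qed.

(** The hypotheses on affine immersions for a cylinder over a quadric of [E^m_q] mapped into
    [E^n_p], gathered so that each map is checked once. The last field is the one that fullness
    rests on. *)
Record cylinder_embedding m n q p (L : 'M[R]_(m + 1, n)) (c0 : 'rV[R]_n) (K : R)
    : Prop := CylinderEmbedding {
  embedding_inj : forall x : 'rV_(m + 1), x *m L = 0 -> x = 0;
  embedding_isom : forall x y : 'rV_(m + 1),
    pform p (x *m L) (y *m L) = pform q (lsubmx x) (lsubmx y);
  embedding_orth : forall x : 'rV_(m + 1), pform p c0 (x *m L) = 0;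
  embedding_norm : pform p c0 c0 = - 1 - K;
  embedding_isotropic : forall xi, (forall x : 'rV_(m + 1), pform p xi (x *m L) = 0) ->
    pform p xi c0 = 0 -> pform p xi xi = 0
}.

Section Cylinder.
Context {m n : nat} (q p : nat) (L : 'M[R]_(m + 1, n)) (c0 : 'rV[R]_n) (K : R).
Hypothesis Lc0 : cylinder_embedding q p L c0 K.
Let phi (z : 'rV[R]_(m + 1)) := z *m L + c0.
Let M := quadric (cylinder_mx m q) K.
Let Mbar := quadric (pmx n p) (-1).

Let isom x y : qf (pmx n p) (x *m L) (y *m L) = qf (cylinder_mx m q) x y.
Proof. by rewrite -pformE (embedding_isom Lc0) qf_cylinder. Qed.

Lemma totally_geodesic_cylinder : c0 = 0 -> totally_geodesic M phi Mbar (pform p).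
Proof.
have [inj _ orth norm _] := Lc0; rewrite pformE in orth norm *.
apply: totally_geodesic_linear => //.
- exact: cylinder_mx_sym.
- exact: pmx_sym.
- exact: qf_pmx_nondeg.
Qed.

Let full_umbilical_lightlike_cylinder r (x v : 'rV[R]_m) : (1 < n)%N ->
  x != 0 -> pform q x x = K -> pform q x v = 0 ->
  K * pform q v v != 0 \/ K = 0 -> lightlike r M phi (qf (pmx n p)) ->
  full_umbilical_lightlike m n.-1 r M (qf (cylinder_mx m q)) phi Mbar (pform p).
Proof.
move=> n1 x0 xx xv Kv.
rewrite -[m in full_umbilical_lightlike m](_ : (m + 1).-1 = m); last by rewrite addn1.
have qE z w : qf (cylinder_mx m q) (row_mx z 0) (row_mx w 0) = pform q z w.
  by rewrite qf_cylinder !row_mxKl.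
have [inj _ orth norm iso] := Lc0; rewrite pformE in orth norm iso *.
apply: (full_umbilical_lightlike_affine _ _ _ inj isom orth norm iso
  (z := row_mx x 0) (v := row_mx v 0)) => //.
- exact: cylinder_mx_sym.
- exact: pmx_sym.
- exact: qf_pmx_nondeg.
- by split; rewrite ?qE// mul_cylinder_mx_eq0 row_mxKl.
- by rewrite qE.
- by rewrite qE.
Qed.

(** For [K != 0] the radical is the kernel of the Gram matrix, that is, the line factor. *)
Lemma full_umbilical_1lightlike_cylinder (x v : 'rV[R]_m) : (1 < n)%N ->
  pform q x x = K -> pform q x v = 0 -> pform q v v != 0 -> K != 0 ->
  full_umbilical_lightlike m n.-1 1 M (qf (cylinder_mx m q)) phi Mbar (pform p).
Proof.
move=> n1 xx xv vv K0; apply: (full_umbilical_lightlike_cylinder (x := x) (v := v)) => //.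
- by apply/eqP => x0; move: K0; rewrite -xx x0 pform0l eqxx.
- by left; rewrite mulf_neq0.
apply: (lightlike_affine _ (@cylinder_mx_sym m q) isom K0 _ (cylinder_kernel_free m)) => //.
exact: cylinder_kernel.
Qed.

(** Over a cone the position vector joins the line factor in the radical, hence rank 2. *)
Lemma full_umbilical_2lightlike_cylinder (x : 'rV[R]_m) : (1 < n)%N ->
  x != 0 -> pform q x x = 0 -> K = 0 ->
  full_umbilical_lightlike m n.-1 2 M (qf (cylinder_mx m q)) phi Mbar (pform p).
Proof.
move=> n1 x0 xx K0; apply: (full_umbilical_lightlike_cylinder (x := x) (v := 0)) => //.
- by rewrite xx K0.
- exact: pform0r.
- by right.
apply: (lightlike_affine0 _ (@cylinder_mx_sym m q) isom K0 (cylinder_kernel_free m)) => //.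
exact: cylinder_kernel.
Qed.

End Cylinder.

Lemma times_hyperbolicE m s (r : R) : r != 0 ->
  times_line (@pseudo_hyperbolic R m s r) = quadric (cylinder_mx m s.+1) (- r ^+ 2).
Proof.
move=> r0; apply: times_lineE => x; rewrite /pseudo_hyperbolic /=.
split=> [xr|[]//]; split=> //; apply/eqP => x0; move/eqP: xr.
by rewrite x0 pform0l eq_sym oppr_eq0 sqrf_eq0 (negbTE r0).
Qed.

Lemma times_sphereE m s (r : R) : r != 0 ->
  times_line (@pseudo_sphere R m s r) = quadric (cylinder_mx m s) (r ^+ 2).
Proof.
move=> r0; apply: times_lineE => x; rewrite /pseudo_sphere /=.
split=> [xr|[]//]; split=> //; apply/eqP => x0; move/eqP: xr.
by rewrite x0 pform0l eq_sym sqrf_eq0 (negbTE r0).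
Qed.

Lemma times_lightconeE m s :
  times_line (lightcone R m s) = quadric (cylinder_mx m s.+1) 0.
Proof. exact: times_lineE. Qed.

Definition space_mx m : 'M[R]_(m + 1, m) := col_mx 1%:M 0.
Definition line_mx m : 'M[R]_(m + 1, 1) := col_mx 0 1%:M.

Lemma mul_space_mx m (z : 'rV[R]_(m + 1)) : z *m space_mx m = lsubmx z.
Proof. by rewrite -{1}[z]hsubmxK mul_row_col mulmx1 mulmx0 addr0. Qed.

Lemma mul_line_mx m (z : 'rV[R]_(m + 1)) : z *m line_mx m = rsubmx z.
Proof. by rewrite -{1}[z]hsubmxK mul_row_col mulmx1 mulmx0 add0r. Qed.

Definition mul_rowE := (mul_mx_row, mul_space_mx, mul_line_mx, mulmx0).

Lemma cylinder_eq0 m (z : 'rV[R]_(m + 1)) : rsubmx z = 0 -> lsubmx z = 0 -> z = 0.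
Proof. by move=> r0 l0; rewrite -[z]hsubmxK r0 l0 row_mx0. Qed.

(** The hypothesis expresses orthogonality to all [(t, x, t)], where [a] is the entry in the first,
    negative, slot and [b] the one in the last, positive, slot. Such vectors have the null form
    [(a, 0, a)] in these slots. *)
Lemma cylinder_annihilator m q (y : 'rV[R]_m) (a b : R) :
  (forall x : 'rV_(m + 1),
    - (a * rsubmx x 0 0) + pform q y (lsubmx x) + b * rsubmx x 0 0 = 0) ->
  y = 0 /\ a = b.
Proof.
move=> h; have y0 : y = 0.
  apply: (@pform_nondeg _ q) => w; have := h (row_mx w 0).
  by rewrite row_mxKl row_mxKr !mxE !mulr0 oppr0 add0r addr0.
split=> //; have := h (row_mx 0 (const_mx 1)).
rewrite row_mxKl row_mxKr mxE !mulr1 pform0r addr0 addrC => /eqP.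
by rewrite subr_eq0 => /eqP.
Qed.

Lemma row_mx_split n1 n2 (x : 'rV[R]_(n1 + n2)) :
  exists (y : 'rV_n1) (z : 'rV_n2), x = row_mx y z.
Proof. by exists (lsubmx x), (rsubmx x); rewrite hsubmxK. Qed.

Section Embeddings.
Context {m : nat}.
Implicit Types (x : 'rV[R]_(m + 1)) (a b u w : 'rV[R]_1) (y : 'rV[R]_m) (c : R).

Definition embed1 : 'M[R]_(m + 1, 1 + (m + 1)) :=
  row_mx (line_mx m) (row_mx (space_mx m) (line_mx m)).

Lemma embed1E x : x *m embed1 = row_mx (rsubmx x) (row_mx (lsubmx x) (rsubmx x)).
Proof. by rewrite !mul_rowE. Qed.

(** Negative coordinates come first, so [q <= m] makes the last slot positive. The two copies of [t]
    then cancel, and the orthogonal of the image is spanned by the null vector [(1, 0, 1)]. *)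
Lemma cylinder_embed1 q : (q <= m)%N ->
  cylinder_embedding q q.+1 embed1 0 (-1).
Proof.
rewrite -subn_eq0 => /eqP qm.
have D a b y a' b' y' : pform q.+1 (row_mx a (row_mx y b)) (row_mx a' (row_mx y' b'))
    = - (a 0 0 * a' 0 0) + pform q y y' + b 0 0 * b' 0 0.
  by rewrite !pform_row pform1S subn1 /= qm pform1_0 addrA.
split=> [x|x x'|x||xi].
- rewrite embed1E => /eqP; rewrite !row_mx_eq0 => /and3P[/eqP ? /eqP ? _].
  exact: cylinder_eq0.
- by rewrite !embed1E D; ring.
- exact: pform0l.
- by rewrite pform0l subrr.
have [a [xi1 ->]] := row_mx_split xi; have [y [b ->]] := row_mx_split xi1.
move=> h _; have [y0 ab] : y = 0 /\ a 0 0 = b 0 0.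
  by apply: (@cylinder_annihilator _ q) => z; rewrite -(h z) embed1E D.
by rewrite D y0 pform0l ab; ring.
Qed.

Definition embed2 : 'M[R]_(m + 1, 1 + (1 + (m + 1))) :=
  row_mx (line_mx m) (row_mx 0 (row_mx (space_mx m) (line_mx m))).

Lemma embed2E x : x *m embed2 =
  row_mx (rsubmx x) (row_mx 0 (row_mx (lsubmx x) (rsubmx x))).
Proof. by rewrite !mul_rowE. Qed.

Definition shift2 c : 'rV[R]_(1 + (1 + (m + 1))) :=
  row_mx 0 (row_mx (const_mx c) (row_mx 0 0)).

(** The constant sits in a second negative slot, so the norm [- 1 - K] of the translation requires
    [c ^+ 2 = 1 + K]. This covers [K = - r ^+ 2] with [r < 1], [K = r ^+ 2] and [K = 0]. *)
Lemma cylinder_embed2 q c K : (q <= m)%N -> c != 0 -> c ^+ 2 = 1 + K ->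
  cylinder_embedding q q.+2 embed2 (shift2 c) K.
Proof.
rewrite -subn_eq0 => /eqP qm c0 cK.
have D a u b y a' u' b' y' :
    pform q.+2 (row_mx a (row_mx u (row_mx y b))) (row_mx a' (row_mx u' (row_mx y' b')))
    = - (a 0 0 * a' 0 0) - u 0 0 * u' 0 0 + pform q y y' + b 0 0 * b' 0 0.
  by rewrite !pform_row !subn1 /= !pform1S qm pform1_0 !addrA.
have z0 : (0 : 'rV[R]_1) 0 0 = 0 by rewrite mxE.
have cE : (const_mx c : 'rV[R]_1) 0 0 = c by rewrite mxE.
split=> [x|x x'|x||xi].
- rewrite embed2E => /eqP; rewrite !row_mx_eq0 => /and4P[/eqP ? _ /eqP ? _].
  exact: cylinder_eq0.
- by rewrite !embed2E D z0; ring.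
- by rewrite embed2E D z0 pform0l; ring.
- by rewrite D z0 cE pform0l -(expr2 c) cK; ring.
have [a [xi1 ->]] := row_mx_split xi; have [u [xi2 ->]] := row_mx_split xi1.
have [y [b ->]] := row_mx_split xi2.
move=> h; have [y0 ab] : y = 0 /\ a 0 0 = b 0 0.
  by apply: (@cylinder_annihilator _ q) => z; rewrite -(h z) embed2E D z0 mulr0 subr0.
rewrite !D y0 !pform0l ab z0 cE => uc.
have -> : u 0 0 = 0 by apply: (mulIf c0); rewrite mul0r; lra.
by ring.
Qed.

Definition embed3 : 'M[R]_(m + 1, 1 + (m + (1 + 1))) :=
  row_mx (line_mx m) (row_mx (space_mx m) (row_mx 0 (line_mx m))).

Lemma embed3E x : x *m embed3 =
  row_mx (rsubmx x) (row_mx (lsubmx x) (row_mx 0 (rsubmx x))).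
Proof. by rewrite !mul_rowE. Qed.

Definition shift3 c : 'rV[R]_(1 + (m + (1 + 1))) :=
  row_mx 0 (row_mx 0 (row_mx (const_mx c) 0)).

(** The constant sits in a positive slot, which reverses the sign: [c ^+ 2 = - 1 - K], possible for
    [K = - r ^+ 2] with [r > 1]. *)
Lemma cylinder_embed3 q c K : (q <= m)%N -> c != 0 -> c ^+ 2 = - 1 - K ->
  cylinder_embedding q q.+1 embed3 (shift3 c) K.
Proof.
rewrite -subn_eq0 => /eqP qm c0 cK.
have D a u b y a' u' b' y' :
    pform q.+1 (row_mx a (row_mx y (row_mx u b))) (row_mx a' (row_mx y' (row_mx u' b')))
    = - (a 0 0 * a' 0 0) + pform q y y' + u 0 0 * u' 0 0 + b 0 0 * b' 0 0.
  by rewrite !pform_row subn1 /= pform1S qm sub0n !pform1_0 !addrA.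
have z0 : (0 : 'rV[R]_1) 0 0 = 0 by rewrite mxE.
have cE : (const_mx c : 'rV[R]_1) 0 0 = c by rewrite mxE.
split=> [x|x x'|x||xi].
- rewrite embed3E => /eqP; rewrite !row_mx_eq0 => /and3P[/eqP ? /eqP ? _].
  exact: cylinder_eq0.
- by rewrite !embed3E D z0; ring.
- by rewrite embed3E D z0 pform0l; ring.
- by rewrite D z0 cE pform0l -(expr2 c) cK; ring.
have [a [xi1 ->]] := row_mx_split xi; have [y [xi2 ->]] := row_mx_split xi1.
have [u [b ->]] := row_mx_split xi2.
move=> h; have [y0 ab] : y = 0 /\ a 0 0 = b 0 0.
  by apply: (@cylinder_annihilator _ q) => z; rewrite -(h z) embed3E D z0 mulr0 addr0.
rewrite !D y0 !pform0l ab z0 cE => uc.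
have -> : u 0 0 = 0 by apply: (mulIf c0); rewrite mul0r; lra.
by ring.
Qed.

Definition embed4 : 'M[R]_(m + 1, 1 + (1 + (m + (1 + 1)))) :=
  row_mx (line_mx m) (row_mx 0 (row_mx (space_mx m) (row_mx 0 (line_mx m)))).

Lemma embed4E x : x *m embed4 =
  row_mx (rsubmx x) (row_mx 0 (row_mx (lsubmx x) (row_mx 0 (rsubmx x)))).
Proof. by rewrite !mul_rowE. Qed.

Definition shift4 : 'rV[R]_(1 + (1 + (m + (1 + 1)))) :=
  row_mx 0 (row_mx (const_mx 1) (row_mx 0 (row_mx (const_mx 1) 0))).

(** The translation is a nonzero null vector. Vectors orthogonal to it and to the image have the
    shape [(a, u, 0, u, a)]: a totally isotropic plane, so all of them are null. *)
Lemma cylinder_embed4 q : (q <= m)%N ->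
  cylinder_embedding q q.+2 embed4 shift4 (-1).
Proof.
rewrite -subn_eq0 => /eqP qm.
have D a u b w y a' u' b' w' y' :
    pform q.+2 (row_mx a (row_mx u (row_mx y (row_mx w b))))
      (row_mx a' (row_mx u' (row_mx y' (row_mx w' b'))))
    = - (a 0 0 * a' 0 0) - u 0 0 * u' 0 0 + pform q y y' + w 0 0 * w' 0 0 + b 0 0 * b' 0 0.
  by rewrite !pform_row !subn1 /= !pform1S qm !pform1_0 !addrA.
have z0 : (0 : 'rV[R]_1) 0 0 = 0 by rewrite mxE.
have cE : (const_mx 1 : 'rV[R]_1) 0 0 = 1 by rewrite mxE.
split=> [x|x x'|x||xi].
- rewrite embed4E => /eqP; rewrite !row_mx_eq0 => /and4P[/eqP ? _ /eqP ? _].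
  exact: cylinder_eq0.
- by rewrite !embed4E D z0; ring.
- by rewrite embed4E D z0 pform0l; ring.
- by rewrite D z0 cE pform0l; ring.
have [a [xi1 ->]] := row_mx_split xi; have [u [xi2 ->]] := row_mx_split xi1.
have [y [xi3 ->]] := row_mx_split xi2; have [w [b ->]] := row_mx_split xi3.
move=> h; have [y0 ab] : y = 0 /\ a 0 0 = b 0 0.
  apply: (@cylinder_annihilator _ q) => z.
  by rewrite -(h z) embed4E D z0 !mulr0 subr0 addr0.
rewrite !D y0 !pform0l ab z0 cE => uw.
have -> : u 0 0 = w 0 0 by lra.
by ring.
Qed.

End Embeddings.

(** * Points of the quadrics and tangent directions for fullness *)

(** The first coordinate is negative, and a second one, available because [m >= 2], supplies the
    tangent direction of norm 1 or -1. *)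
Lemma pform_negative_witness m q (r : R) : (1 < m)%N ->
  exists x v : 'rV[R]_m,
    [/\ pform q.+1 x x = - r ^+ 2, pform q.+1 x v = 0 & pform q.+1 v v != 0].
Proof.
move=> m1; pose i := Ordinal (ltnW m1); pose j := Ordinal m1.
exists (r *: delta_mx 0 i), (delta_mx 0 j).
rewrite pformE !qfZl !qfZr -pformE !pform_delta !eqxx /=; split; first ring.
  by rewrite mulr0.
by case: ifP => _; rewrite ?oppr_eq0 oner_eq0.
Qed.

(** [q < m] makes the last coordinate positive; the first one gives the tangent direction. *)
Lemma pform_positive_witness m q (r : R) : (1 < m)%N -> (q < m)%N ->
  exists x v : 'rV[R]_m,
    [/\ pform q x x = r ^+ 2, pform q x v = 0 & pform q v v != 0].
Proof.
case: m => // m m1 qm; pose i : 'I_m.+1 := ord0.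
exists (r *: delta_mx 0 ord_max), (delta_mx 0 i).
rewrite pformE !qfZl !qfZr -pformE !pform_delta !eqxx /= ltnNge -ltnS qm /=.
split; first ring.
  by rewrite -val_eqE /= gtn_eqF// mulr0.
by case: ifP => _; rewrite ?oppr_eq0 oner_eq0.
Qed.

(** The first coordinate is negative and the last is positive, so the sum of the two basis vectors
    is null. *)
Lemma pform_null_witness m q : (q.+1 < m)%N ->
  exists2 x : 'rV[R]_m, x != 0 & pform q.+1 x x = 0.
Proof.
case: m => [|[|m]]// qm; pose i : 'I_m.+2 := ord0; pose j : 'I_m.+2 := ord_max.
have ij : (i == j) = false by [].
exists (delta_mx 0 i + delta_mx 0 j).
  apply/eqP => /rowP/(_ i); rewrite !mxE eqxx ij addr0 => /eqP.
  by rewrite oner_eq0.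
rewrite pformE !qfDl !qfDr -pformE !pform_delta !eqxx ij (eq_sym j) ij /=.
by rewrite ltnNge -ltnS qm /= add0r addr0 addNr.
Qed.

End PseudoEuclidean.
Theorem proposition11 (R : realType) (m : nat) (hm : (2 <= m)%N) :
  (* (1) *)
  (forall s : nat, (s < m)%N ->
    let M := times_line (@pseudo_hyperbolic R m s 1) in
    let phi := fun z : 'rV[R]_(m + 1) =>
      let x := lsubmx z in let t := rsubmx z in
      row_mx t (row_mx x t) in
    let Mbar := @pseudo_hyperbolic R (1 + (m + 1)) s.+1 1 in
    full_umbilical_lightlike m m.+1 1 M (times_line_form (pform s.+1))
      phi Mbar (pform s.+2)
    /\ totally_geodesic M phi Mbar (pform s.+2)) /\
  (* (2) *)
  (forall (s : nat) (r : R), (s < m)%N -> 0 < r -> r < 1 ->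
    full_umbilical_lightlike m m.+2 1
      (times_line (@pseudo_hyperbolic R m s r)) (times_line_form (pform s.+1))
      (fun z : 'rV[R]_(m + 1) =>
        let x := lsubmx z in let t := rsubmx z in
        row_mx t (row_mx (const_mx (Num.sqrt (1 - r ^+ 2)) : 'rV[R]_1)
          (row_mx x t)))
      (@pseudo_hyperbolic R (1 + (1 + (m + 1))) s.+2 1) (pform s.+3)) /\
  (* (3) *)
  (forall (s : nat) (r : R), (s < m)%N -> 1 < r ->
    full_umbilical_lightlike m m.+2 1
      (times_line (@pseudo_hyperbolic R m s r)) (times_line_form (pform s.+1))
      (fun z : 'rV[R]_(m + 1) =>
        let x := lsubmx z in let t := rsubmx z in
        row_mx t (row_mx x
          (row_mx (const_mx (Num.sqrt (r ^+ 2 - 1)) : 'rV[R]_1) t)))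
      (@pseudo_hyperbolic R (1 + (m + (1 + 1))) s.+1 1) (pform s.+2)) /\
  (* (4) *)
  (forall (s : nat) (r : R), (s < m)%N -> 0 < r ->
    full_umbilical_lightlike m m.+2 1
      (times_line (@pseudo_sphere R m s r)) (times_line_form (pform s))
      (fun z : 'rV[R]_(m + 1) =>
        let x := lsubmx z in let t := rsubmx z in
        row_mx t (row_mx (const_mx (Num.sqrt (1 + r ^+ 2)) : 'rV[R]_1)
          (row_mx x t)))
      (@pseudo_hyperbolic R (1 + (1 + (m + 1))) s.+1 1) (pform s.+2)) /\
  (* (5) *)
  (forall s : nat, (s < m)%N ->
    full_umbilical_lightlike m m.+1 1
      (lightcone R m.+1 s) (pform s.+1)
      (fun x : 'rV[R]_m.+1 => row_mx (const_mx 1 : 'rV[R]_1) x)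
      (@pseudo_hyperbolic R (1 + m.+1) s.+1 1) (pform s.+2)) /\
  (* (6) *)
  (forall s : nat, (s.+1 < m)%N ->
    full_umbilical_lightlike m m.+2 2
      (times_line (lightcone R m s)) (times_line_form (pform s.+1))
      (fun z : 'rV[R]_(m + 1) =>
        let x := lsubmx z in let t := rsubmx z in
        row_mx t (row_mx (const_mx 1 : 'rV[R]_1) (row_mx x t)))
      (@pseudo_hyperbolic R (1 + (1 + (m + 1))) s.+2 1) (pform s.+3)) /\
  (* (7) *)
  (forall s : nat, (s < m)%N ->
    full_umbilical_lightlike m m.+3 1
      (times_line (@pseudo_hyperbolic R m s 1)) (times_line_form (pform s.+1))
      (fun z : 'rV[R]_(m + 1) =>
        let x := lsubmx z in let t := rsubmx z in
        row_mx t (row_mx (const_mx 1 : 'rV[R]_1)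
          (row_mx x (row_mx (const_mx 1 : 'rV[R]_1) t))))
      (@pseudo_hyperbolic R (1 + (1 + (m + (1 + 1)))) s.+2 1) (pform s.+3)).
Proof.
have K1 : (-1 : R) != 0 by rewrite oppr_eq0 oner_eq0.
split; [|split; [|split; [|split; [|split; [|split]]]]].
- move=> s sm M phi Mbar; have emb := cylinder_embed1 (R := R) sm.
  have phiE : phi = fun z => z *m embed1 + 0.
    by apply/funext => z; rewrite addr0 embed1E.
  have [x [v [xx xv vv]]] := pform_negative_witness s (1 : R) hm.
  rewrite phiE /M /Mbar times_line_formE times_hyperbolicE ?oner_eq0//.
  rewrite expr1n in xx *; rewrite pseudo_hyperbolicE.
  split; last exact: (totally_geodesic_cylinder emb erefl).
  have <- : (1 + (m + 1)).-1 = m.+1 by rewrite addn1.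
  by apply: (full_umbilical_1lightlike_cylinder emb _ xx xv vv K1); rewrite addn1.
- move=> s r sm r0 r1.
  set c := Num.sqrt (1 - r ^+ 2); set phi := fun z => _.
  have c_gt0 : 0 < 1 - r ^+ 2 by rewrite subr_gt0 expr_lt1 ?ltW.
  have phiE : phi = fun z => z *m embed2 + shift2 c.
    by apply/funext => z; rewrite embed2E !add_row_mx !addr0 add0r.
  have emb : cylinder_embedding s.+1 s.+3 (@embed2 R m) (shift2 c) (- r ^+ 2).
    apply: cylinder_embed2 => //; first by rewrite gt_eqF// sqrtr_gt0.
    by rewrite sqr_sqrtr// ltW.
  have [x [v [xx xv vv]]] := pform_negative_witness s r hm.
  rewrite phiE times_line_formE times_hyperbolicE ?gt_eqF// pseudo_hyperbolicE.
  have <- : (1 + (1 + (m + 1))).-1 = m.+2 by rewrite addn1.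
  apply: (full_umbilical_1lightlike_cylinder emb _ xx xv vv _) => //.
  by rewrite oppr_eq0 sqrf_eq0 gt_eqF.
- move=> s r sm r1; have r0 : 0 < r by exact: lt_trans r1.
  set c := Num.sqrt (r ^+ 2 - 1); set phi := fun z => _.
  have c_gt0 : 0 < r ^+ 2 - 1 by rewrite subr_gt0 expr_gt1// ltW.
  have phiE : phi = fun z => z *m embed3 + shift3 c.
    by apply/funext => z; rewrite embed3E !add_row_mx !addr0 add0r.
  have emb : cylinder_embedding s.+1 s.+2 (@embed3 R m) (shift3 c) (- r ^+ 2).
    apply: cylinder_embed3 => //; first by rewrite gt_eqF// sqrtr_gt0.
    by rewrite sqr_sqrtr ?ltW// opprK addrC.
  have [x [v [xx xv vv]]] := pform_negative_witness s r hm.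
  rewrite phiE times_line_formE times_hyperbolicE ?gt_eqF// pseudo_hyperbolicE.
  have <- : (1 + (m + (1 + 1))).-1 = m.+2 by exact: addn2.
  apply: (full_umbilical_1lightlike_cylinder emb _ xx xv vv _).
    by rewrite ltnS addn_gt0 orbT.
  by rewrite oppr_eq0 sqrf_eq0 gt_eqF.
- move=> s r sm r0.
  set c := Num.sqrt (1 + r ^+ 2); set phi := fun z => _.
  have c_gt0 : 0 < 1 + r ^+ 2 by rewrite ltr_wpDr ?sqr_ge0.
  have phiE : phi = fun z => z *m embed2 + shift2 c.
    by apply/funext => z; rewrite embed2E !add_row_mx !addr0 add0r.
  (* The sphere lies in a space of index [s], the hyperbolic factors in one of index [s.+1]; hence
     the target index drops by one compared with the same map on a hyperbolic factor. *)
  have emb : cylinder_embedding s s.+2 (@embed2 R m) (shift2 c) (r ^+ 2).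
    apply: cylinder_embed2; [exact: ltnW|by rewrite gt_eqF// sqrtr_gt0|].
    by rewrite sqr_sqrtr// ltW.
  have [x [v [xx xv vv]]] := pform_positive_witness r hm sm.
  rewrite phiE times_line_formE times_sphereE ?gt_eqF// pseudo_hyperbolicE.
  have <- : (1 + (1 + (m + 1))).-1 = m.+2 by rewrite addn1.
  apply: (full_umbilical_1lightlike_cylinder emb _ xx xv vv _) => //.
  by rewrite sqrf_eq0 gt_eqF.
(* There is no line factor here, so the affine results are applied directly, with [L] the inclusion
   [x |-> (0, x)] and [c0 = (1, 0)]. *)
- move=> s sm; set phi := fun x => _.
  pose L : 'M[R]_(m.+1, 1 + m.+1) := row_mx 0 1%:M.
  pose c0 : 'rV[R]_(1 + m.+1) := row_mx (const_mx 1) 0.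
  have LE (x : 'rV[R]_m.+1) : x *m L = row_mx 0 x by rewrite mul_mx_row mulmx0 mulmx1.
  have phiE : phi = fun x => x *m L + c0.
    by apply/funext => x; rewrite LE add_row_mx addr0 add0r.
  have D (a a' : 'rV[R]_1) (x x' : 'rV[R]_m.+1) :
      qf (pmx _ s.+2) (row_mx a x) (row_mx a' x') =
      - (a 0 0 * a' 0 0) + qf (pmx _ s.+1) x x'.
    by rewrite -!pformE pform_row pform1S subn1.
  have z0 : (0 : 'rV[R]_1) 0 0 = 0 by rewrite mxE.
  have cE : (const_mx 1 : 'rV[R]_1) 0 0 = 1 by rewrite mxE.
  have [x x0 xx] := @pform_null_witness R m.+1 s sm.
  have isom (y y' : 'rV[R]_m.+1) :
    qf (pmx _ s.+2) (y *m L) (y' *m L) = qf (pmx _ s.+1) y y'.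
    by rewrite !LE D z0 mul0r oppr0 add0r.
  rewrite phiE lightconeE pseudo_hyperbolicE !pformE.
  apply: (full_umbilical_lightlike_affine (k := m.+1) (n := 1 + m.+1) _ _ _ _ isom
    _ _ _ (z := x) (v := 0)).
  + exact: pmx_sym.
  + exact: pmx_sym.
  + exact: qf_pmx_nondeg.
  + by move=> y; rewrite LE => /eqP; rewrite row_mx_eq0 => /andP[_ /eqP].
  + by move=> y; rewrite LE D z0 mulr0 oppr0 add0r qf0l.
  + by rewrite D cE qf0l; ring.
  (* The image of [L] and [c0] span the whole space, so [xi] is even zero. *)
  + move=> xi; have [a [y ->]] := row_mx_split xi => h.
    have -> : y = 0.
      apply: (@qf_pmx_nondeg _ _ s.+1) => w; have := h w.
      by rewrite LE D z0 mulr0 oppr0 add0r.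
    rewrite !D !qf0l cE !addr0 mulr1 => /eqP; rewrite oppr_eq0 => /eqP ->.
    by rewrite mul0r oppr0.
  + by [].
  + by split; rewrite ?pmx_mul_eq0// -pformE.
  + exact: qf0r.
  + by right.
  (* The Gram matrix has trivial kernel, with the empty matrix as basis; the rank of the radical is
     [1 + 0], from the position vector alone. *)
  + apply: (lightlike_affine0 (A := 0 : 'M[R]_(0, m.+1)) _ (@pmx_sym _ m.+1 s.+1) isom).
    * by [].
    * by apply: inj_row_free => v _; exact: thinmx0.
    * move=> v; split=> [/eqP|/submxP[b ->]]; last by rewrite (thinmx0 b) !mul0mx.
      by rewrite pmx_mul_eq0 => /eqP ->; exact: sub0mx.
- move=> s sm; set phi := fun z => _.
  have phiE : phi = fun z => z *m embed2 + shift2 1.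
    by apply/funext => z; rewrite embed2E !add_row_mx !addr0 add0r.
  have emb : cylinder_embedding s.+1 s.+3 (@embed2 R m) (shift2 1) 0.
    by apply: cylinder_embed2; [exact: ltnW|exact: oner_neq0|rewrite expr1n addr0].
  have [x x0 xx] := @pform_null_witness R m s sm.
  rewrite phiE times_line_formE times_lightconeE pseudo_hyperbolicE.
  have <- : (1 + (1 + (m + 1))).-1 = m.+2 by rewrite addn1.
  exact: (full_umbilical_2lightlike_cylinder emb _ x0 xx _).
- move=> s sm; set phi := fun z => _; have emb := cylinder_embed4 (R := R) sm.
  have phiE : phi = fun z => z *m embed4 + shift4.
    by apply/funext => z; rewrite embed4E !add_row_mx !addr0 !add0r.
  have [x [v [xx xv vv]]] := pform_negative_witness s (1 : R) hm.
  rewrite phiE times_line_formE times_hyperbolicE ?oner_eq0//.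
  rewrite expr1n in xx *; rewrite pseudo_hyperbolicE.
  have <- : (1 + (1 + (m + (1 + 1)))).-1 = m.+3 by exact: (congr1 S (addn2 m)).
  exact: (full_umbilical_1lightlike_cylinder emb _ xx xv vv K1).
Qed.
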